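(* Let $m\ge 1$ be an integer. (a) If $1\le k=n\le m+1$, then $\pi_p(W_{k,n}(S^m))\cong\pi_p(V_{m+1,n})$ for all $p\ge 1$. (b) If $1\le k=n-1=m$ (that is, $k=m$ and $n=m+1$), then \[ \pi_p(W_{k,n}(S^m))\cong \pi_p(V_{m+1,m})\oplus\pi_p\bigl(S^m-Q_{m-1,m}(S^m)_{b_m}\bigr)\quad\text{for all } p\ge 1 . \] (c) $\pi_p(W_{m+1,m+2}(S^m),\tilde b_{m+1})\cong\pi_p(V_{m+1,m+1},b_{m+1})$ for all $p\ge 1$.
   Context: $S^m\subset\mathbb{R}^{m+1}$ is the unit sphere and $e_1,\dots,e_{m+1}$ are the standard basis vectors of $\mathbb{R}^{m+1}$. For $n\ge k\ge 1$ the generalized configuration space is \[ W_{k,n}(S^m)=\{(p_1,\dots,p_n)\in (S^m)^n \mid \text{for every } k\text{-element subset } \{i_1,\dots,i_k\}\subset\{1,\dots,n\},\ p_{i_1},\dots,p_{i_k}\text{ are linearly independent}\}, \] with the topology induced from $(S^m)^n$. For $p=(p_1,\dots,p_n)\in W_{k,n}(S^m)$ put \[ Q_{k-1,n}(S^m)_p=\bigcup_{\{i_1,\dots,i_{k-1}\}\subset\{1,\dots,n\}}\{x\in S^m\mid x,p_{i_1},\dots,p_{i_{k-1}}\text{ are linearly dependent}\}, \] the union being over all $(k-1)$-element subsets; in (b) it is used with $k=n=m$ and $p=b_m$. The Stiefel manifold is $V_{m,n}=\{(v_1,\dots,v_n)\mid v_i\in\mathbb{R}^m,\ \langle v_i,v_j\rangle=\delta_{i,j},\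 1\le i,j\le n\}$. Notation: $b_k=(e_1,\dots,e_k)$ and $\tilde b_k=\bigl(e_1,\dots,e_k,\tfrac{e_1+\cdots+e_k}{\|e_1+\cdots+e_k\|}\bigr)$. Where no base point is displayed, the base points are: $b_n$ for $W_{n,n}(S^m)$ and for $V_{m+1,n}$, $b_{m+1}$ for $W_{m,m+1}(S^m)$, and $e_{m+1}$ for $S^m-Q_{m-1,m}(S^m)_{b_m}$. For $p=1$, $\oplus$ denotes the direct product of groups. *)

(* Defs.v *)
From HB Require Import structures.
From mathcomp Require Import all_boot all_order all_algebra.
From mathcomp Require Import all_classical all_reals all_analysis.
From mathcomp Require Import generic_quotient ring lra.
Import Order.TTheory GRing.Theory Num.Theory.
Import numFieldNormedType.Exports.

Set Implicit Arguments.
Unset Strict Implicit.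
Unset Printing Implicit Defensive.

Local Open Scope classical_set_scope.
Local Open Scope ring_scope.
Local Open Scope quotient_scope.

Section WithinContinuity.

Lemma within_comp (Y Z X : topologicalType) (A : set Y) (B : set Z)
    (f : Z -> X) (h : Y -> Z) :
  {within B, continuous f} -> continuous h -> (forall y, A y -> B (h y)) ->
  {within A, continuous (f \o h)}.
Proof.
move=> /subspace_continuousP cf ch AB; apply/subspace_continuousP => y Ay.
apply: (cvg_trans _ (cf _ (AB _ Ay))) => U /=.
rewrite !nbhs_simpl /= !withinE => -[V nV UV].
exists (h @^-1` V); first exact: ch nV.
apply/seteqP; split=> z [/= zU Az]; split=> //.
  have : (f @^-1` U `&` B) (h z) by split=> //; exact: AB.
  by rewrite UV => -[].
have : (V `&` B) (h z) by split=> //; exact: AB.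
by rewrite -UV => -[].
Qed.

Lemma eq_within (Y X : topologicalType) (A : set Y) (f g : Y -> X) :
  (forall y, A y -> f y = g y) ->
  {within A, continuous f} -> {within A, continuous g}.
Proof.
move=> fg; apply: subspace_eq_continuous => y /set_mem Ay; exact: fg.
Qed.

Lemma within_paste (R : realType) (Y X : topologicalType) (A : set Y)
    (h : Y -> R) (c : R) (F G : Y -> X) :
  closed A -> continuous h ->
  {within [set y | A y /\ h y <= c], continuous F} ->
  {within [set y | A y /\ c <= h y], continuous G} ->
  (forall y, A y -> h y = c -> F y = G y) ->
  {within A, continuous (fun y => if h y <= c then F y else G y)}.
Proof.
move=> cA ch cF cG FG.
have -> : A = [set y | A y /\ h y <= c] `|` [set y | A y /\ c <= h y].
  apply/seteqP; split=> [y Ay|y [[]|[]]//].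
  by case: (lerP (h y) c) => hc; [left|right]; split=> //; apply: ltW.
apply: withinU_continuous.
- apply: (closedI cA).
  by move/continuous_closedP: ch => /(_ _ (@closed_le R c)).
- apply: (closedI cA).
  by move/continuous_closedP: ch => /(_ _ (@closed_ge R c)).
- by apply: eq_within cF => y [Ay ->].
- apply: eq_within cG => y [Ay hc]; case: ifP => // hc'.
  by apply/esym/FG => //; apply/eqP; rewrite eq_le hc hc'.
Qed.

Lemma continuous_mxP (Y T : topologicalType) (m n : nat) (f : Y -> 'M[T]_(m, n)) :
  (forall i j, continuous (fun y => f y i j)) -> continuous f.
Proof.
move=> cf y U [P nP PU]; rewrite nbhs_simpl /=.
have : \forall z \near y, forall ij : 'I_m * 'I_n, P ij.1 ij.2 (f z ij.1 ij.2).
  by apply: filter_forall => -[i j]; exact: cf (nP i j).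
by apply: filterS => z Pz; apply: PU => i j; exact: (Pz (i, j)).
Qed.

End WithinContinuity.

Section ContinuousExpressions.
Variables (R : realType) (Y Z T : topologicalType).
Implicit Types a b : Y -> R.

Lemma cts_cst (z : Z) : continuous (fun _ : Y => z).
Proof. by move=> y; exact: cvg_cst. Qed.

Lemma cts_id : continuous (fun y : Y => y).
Proof. by move=> y; exact: cvg_id. Qed.

Lemma cts_fst : continuous (fun y : Y * Z => y.1).
Proof. by move=> y; exact: cvg_fst. Qed.

Lemma cts_snd : continuous (fun y : Y * Z => y.2).
Proof. by move=> y; exact: cvg_snd. Qed.

Lemma cts_comp (f : Y -> Z) (g : Z -> T) :
  continuous f -> continuous g -> continuous (fun y => g (f y)).
Proof. by move=> cf cg y; apply: continuous_comp; [exact: cf|exact: cg]. Qed.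

Lemma cts_pair (f : Y -> Z) (g : Y -> T) :
  continuous f -> continuous g -> continuous (fun y => (f y, g y)).
Proof. by move=> cf cg y; apply: cvg_pair; [exact: cf|exact: cg]. Qed.

Lemma ctsD a b :
  continuous a -> continuous b -> continuous (fun y => a y + b y).
Proof. by move=> ca cb y; exact: (continuousD (ca y) (cb y)). Qed.

Lemma ctsB a b :
  continuous a -> continuous b -> continuous (fun y => a y - b y).
Proof. by move=> ca cb y; exact: (continuousB (ca y) (cb y)). Qed.

Lemma ctsM a b :
  continuous a -> continuous b -> continuous (fun y => a y * b y).
Proof. by move=> ca cb y; exact: (continuousM (ca y) (cb y)). Qed.

Lemma cts_min a b :
  continuous a -> continuous b -> continuous (fun y => Num.min (a y) (b y)).
Proof. by move=> ca cb y; exact: (continuous_min (ca y) (cb y)). Qed.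

Lemma cts_max a b :
  continuous a -> continuous b -> continuous (fun y => Num.max (a y) (b y)).
Proof. by move=> ca cb y; exact: (continuous_max (ca y) (cb y)). Qed.

Lemma cts_coord m n (i : 'I_m) (j : 'I_n) (f : Y -> 'M[R]_(m, n)) :
  continuous f -> continuous (fun y => f y i j).
Proof.
move=> cf y; apply: (@continuous_comp _ _ _ f (fun M : 'M[R]_(m, n) => M i j)).
  exact: cf.
exact: coord_continuous.
Qed.

End ContinuousExpressions.

Section Spheroids.
Variables (R : realType) (X : topologicalType).
Implicit Types n : nat.

Definition unit_cube n : set 'rV[R]_n := [set s | forall i, 0 <= s 0 i <= 1].

Definition cube_boundary n : set 'rV[R]_n :=
  [set s | unit_cube s /\ exists i, s 0 i = 0 \/ s 0 i = 1].

(* Maps (I^n, dI^n) -> (X, x0); values outside the cube are irrelevant, and   *)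
(* [homotopic] identifies maps that agree on the cube.                        *)
Definition spheroids n (x0 : X) : set ('rV[R]_n -> X) :=
  [set f | {within @unit_cube n, continuous f} /\
           forall s, cube_boundary s -> f s = x0].

Definition homotopic n (x0 : X) (f g : 'rV[R]_n -> X) : Prop :=
  exists H : 'rV[R]_n * R -> X,
    [/\ {within @unit_cube n `*` `[0, 1], continuous H},
        forall s, unit_cube s -> H (s, 0) = f s,
        forall s, unit_cube s -> H (s, 1) = g s &
        forall s (t : R), cube_boundary s -> 0 <= t <= 1 -> H (s, t) = x0].

Definition with_first n (s : 'rV[R]_n.+1) (a : R) : 'rV[R]_n.+1 :=
  \row_i if i == ord0 then a else s 0 i.

Definition concat n (f g : 'rV[R]_n.+1 -> X) (s : 'rV[R]_n.+1) : X :=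
  if s 0 ord0 <= 2^-1 then f (with_first s (2 * s 0 ord0))
  else g (with_first s (2 * s 0 ord0 - 1)).

Definition reverse n (f : 'rV[R]_n.+1 -> X) (s : 'rV[R]_n.+1) : X :=
  f (with_first s (1 - s 0 ord0)).

Lemma with_first_continuous (Y : topologicalType) n (u : Y -> 'rV[R]_n.+1)
    (a : Y -> R) :
  continuous u -> continuous a -> continuous (fun y => with_first (u y) (a y)).
Proof.
move=> cu ca; apply: continuous_mxP => i j.
have [->|jn0] := eqVneq j ord0.
  by under eq_fun do rewrite mxE eqxx; exact: ca.
under eq_fun do rewrite mxE (negbTE jn0).
exact: cts_coord.
Qed.

Ltac cts := lazymatch goal with
  | |- continuous id => exact: cts_id
  | |- continuous fst => exact: cts_fst
  | |- continuous snd => exact: cts_snd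
  | |- continuous (fun y => y) => exact: cts_id
  | |- continuous (fun y => y.1) => exact: cts_fst
  | |- continuous (fun y => y.2) => exact: cts_snd
  | |- continuous (fun _ => ?c) => exact: cts_cst
  | |- continuous (fun y => @?a y - @?b y) => apply: (@ctsB _ _ a b); cts
  | |- continuous (fun y => @?a y + @?b y) => apply: (@ctsD _ _ a b); cts
  | |- continuous (fun y => @?a y * @?b y) => apply: (@ctsM _ _ a b); cts
  | |- continuous (fun y => Num.min (@?a y) (@?b y)) =>
      apply: (@cts_min _ _ a b); cts
  | |- continuous (fun y => Num.max (@?a y) (@?b y)) =>
      apply: (@cts_max _ _ a b); cts
  | |- continuous (fun y => (@?f y, @?g y)) =>
      apply: (@cts_pair _ _ _ f g); cts
  | |- continuous (fun y => @fun_of_matrix _ _ _ (@?f y) ?i ?j) =>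
      apply: (@cts_coord _ _ _ _ i j f); cts
  | |- continuous (fun y => with_first (@?u y) (@?a y)) =>
      apply: (@with_first_continuous _ _ u a); cts
  | |- continuous (fun y => ?g (@?f y)) =>
      apply: (@cts_comp _ _ _ f g); cts
  | _ => idtac
  end.

Lemma with_first0 n (s : 'rV[R]_n.+1) a : with_first s a 0 ord0 = a.
Proof. by rewrite mxE eqxx. Qed.

Lemma with_firstK n (s : 'rV[R]_n.+1) a b :
  with_first (with_first s a) b = with_first s b.
Proof. by apply/rowP => i; rewrite !mxE; case: eqP. Qed.

Lemma with_first_id n (s : 'rV[R]_n.+1) : with_first s (s 0 ord0) = s.
Proof. by apply/rowP => i; rewrite mxE; case: ifP => // /eqP ->. Qed.

Lemma unit_cube_with_first n (s : 'rV[R]_n.+1) a :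
  unit_cube s -> 0 <= a <= 1 -> unit_cube (with_first s a).
Proof. by move=> cs a01 i; rewrite mxE; case: ifP. Qed.

Lemma boundary_with_first n (s : 'rV[R]_n.+1) a : cube_boundary s ->
  0 <= a <= 1 -> (s 0 ord0 = 0 \/ s 0 ord0 = 1 -> a = 0 \/ a = 1) ->
  cube_boundary (with_first s a).
Proof.
move=> [cs [i si]] a01 sa; split; first exact: unit_cube_with_first.
exists i; rewrite mxE; case: eqP => // ieq; rewrite ieq in si.
exact: sa.
Qed.

Lemma boundary_first n (s : 'rV[R]_n.+1) a :
  unit_cube s -> a = 0 \/ a = 1 -> cube_boundary (with_first s a).
Proof.
move=> cs a01; split; last by exists ord0; rewrite with_first0.
by apply: unit_cube_with_first => //; case: a01 => ->; rewrite lexx ler01.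
Qed.

Lemma first01 n (s : 'rV[R]_n.+1) : unit_cube s -> 0 <= s 0 ord0 <= 1.
Proof. by move=> /(_ ord0). Qed.

Lemma closed_unit_cube n : closed (@unit_cube n).
Proof.
rewrite [X in closed X](_ : _ =
    \bigcap_(i in [set: 'I_n]) [set s : 'rV[R]_n | 0 <= s 0 i <= 1]); last first.
  by apply/seteqP; split=> [s h i _|s h i]; exact: h.
apply: closed_bigI => i _ /=.
rewrite [X in closed X](_ : _ = (fun s : 'rV[R]_n => s 0 i) @^-1` `[0, 1]).
  have /continuous_closedP cP := @coord_continuous R 1 n 0 i.
  by apply: cP; exact: itv_closed.
by apply/seteqP; split=> s /=; rewrite in_itv.
Qed.

Lemma closed_cylinder n : closed (@unit_cube n `*` `[0, 1]%classic : set ('rV[R]_n * R)).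
Proof.
rewrite [X in closed X](_ : _ = (fst @^-1` @unit_cube n) `&`
   (snd @^-1` `[0, 1]%classic : set ('rV[R]_n * R))) //.
have /continuous_closedP c1 : continuous (@fst 'rV[R]_n R).
  by move=> x; exact: cvg_fst.
have /continuous_closedP c2 : continuous (@snd 'rV[R]_n R).
  by move=> x; exact: cvg_snd.
by apply: closedI; [apply: c1; exact: closed_unit_cube|apply: c2; exact: itv_closed].
Qed.

Lemma concat_cut n x0 (f g : 'rV[R]_n.+1 -> X) s :
  spheroids x0 f -> spheroids x0 g -> unit_cube s -> s 0 ord0 = 2^-1 ->
  f (with_first s (2 * s 0 ord0)) = g (with_first s (2 * s 0 ord0 - 1)).
Proof.
move=> [_ f0] [_ g0] cs ->; rewrite mulfV ?pnatr_eq0// subrr.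
by rewrite f0 ?g0//; apply: boundary_first => //; [left|right].
Qed.

Lemma concat_spheroid n x0 (f g : 'rV[R]_n.+1 -> X) :
  spheroids x0 f -> spheroids x0 g -> spheroids x0 (concat f g).
Proof.
move=> Sf Sg; split.
  have c0 : continuous (fun s : 'rV[R]_n.+1 => s 0 ord0) by cts.
  apply: (within_paste (@closed_unit_cube _) c0).
  - apply: (@within_comp _ _ _ _ (@unit_cube n.+1) f
      (fun s => with_first s (2 * s 0 ord0))) => //; first exact: Sf.1.
      by cts.
    move=> s [cs hs]; apply: unit_cube_with_first => //.
    by have := first01 cs; lra.
  - apply: (@within_comp _ _ _ _ (@unit_cube n.+1) g
      (fun s => with_first s (2 * s 0 ord0 - 1))) => //; first exact: Sg.1.
      by cts.
    move=> s [cs hs]; apply: unit_cube_with_first => //.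
    by have := first01 cs; lra.
  - by move=> s cs hs; apply: concat_cut Sf Sg cs hs.
move=> s bs; have h01 := first01 bs.1; rewrite /concat; case: ifPn => hs.
  apply: Sf.2; apply: boundary_with_first => //; first lra.
  by move=> [] e; rewrite e in hs *; [left|exfalso]; lra.
apply: Sg.2; apply: boundary_with_first => //; first lra.
by move=> [] e; rewrite e in hs *; [exfalso|right]; lra.
Qed.

Lemma reverse_spheroid n x0 (f : 'rV[R]_n.+1 -> X) :
  spheroids x0 f -> spheroids x0 (reverse f).
Proof.
move=> [cf f0]; split.
  apply: (@within_comp _ _ _ _ (@unit_cube n.+1) f
    (fun s => with_first s (1 - s 0 ord0))) => //.
    by cts.
  move=> s cs; apply: unit_cube_with_first => //.
  by have := first01 cs; lra.
move=> s bs; apply: f0; have h01 := first01 bs.1.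
apply: boundary_with_first => //; first lra.
by move=> [] ->; [right|left]; lra.
Qed.

Lemma const_spheroid n x0 : spheroids x0 (fun _ : 'rV[R]_n => x0).
Proof. by split=> // s; exact: cvg_cst. Qed.

Lemma homotopic_refl n x0 (f : 'rV[R]_n -> X) :
  spheroids x0 f -> homotopic x0 f f.
Proof.
move=> [cf f0]; exists (f \o fst); split=> //=.
  apply: within_comp cf _ _ => [x|x []//]; exact: cvg_fst.
by move=> s t bs _; exact: f0.
Qed.

Lemma homotopic_sym n x0 (f g : 'rV[R]_n -> X) :
  homotopic x0 f g -> homotopic x0 g f.
Proof.
move=> [H [cH H0 H1 Hb]]; exists (fun y : 'rV[R]_n * R => H (y.1, 1 - y.2)); split.
- apply: (@within_comp _ _ _ _ _ H (fun y : 'rV[R]_n * R => (y.1, 1 - y.2)) cH).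
    by cts.
  by move=> y [cy ty]; split=> //=; move: ty; rewrite /= !in_itv /=; lra.
- by move=> s cs /=; rewrite subr0 H1.
- by move=> s cs /=; rewrite subrr H0.
- by move=> s t bs t01 /=; apply: Hb => //; lra.
Qed.

Lemma homotopic_trans n x0 (f g h : 'rV[R]_n -> X) :
  homotopic x0 f g -> homotopic x0 g h -> homotopic x0 f h.
Proof.
move=> [H [cH H0 H1 Hb]] [K [cK K0 K1 Kb]].
exists (fun y : 'rV[R]_n * R => if y.2 <= 2^-1 then H (y.1, 2 * y.2)
                 else K (y.1, 2 * y.2 - 1)); split.
- apply: (within_paste (@closed_cylinder n) (@cts_snd _ _)).
  + apply: (@within_comp _ _ _ _ _ H (fun y : 'rV[R]_n * R => (y.1, 2 * y.2)) cH).
      by cts.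
    by move=> y [[cy ty] hy]; split=> //=; move: ty; rewrite /= !in_itv /=; lra.
  + apply: (@within_comp _ _ _ _ _ K (fun y : 'rV[R]_n * R => (y.1, 2 * y.2 - 1)) cK).
      by cts.
    by move=> y [[cy ty] hy]; split=> //=; move: ty; rewrite /= !in_itv /=; lra.
  + by move=> y [cy _] ->; rewrite mulfV ?pnatr_eq0// subrr H1// K0.
- by move=> s cs /=; rewrite invr_ge0 ler0n mulr0 H0.
- move=> s cs /=; rewrite ifF; last by apply/negbTE; rewrite -ltNge; lra.
  by rewrite mulr1 (_ : 2 - 1 = 1) ?K1//; lra.
- move=> s t bs t01 /=; case: ifPn => ht; first by apply: Hb => //; lra.
  by apply: Kb => //; lra.
Qed.

Lemma concat_homotopic n x0 (f f' g g' : 'rV[R]_n.+1 -> X) :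
  homotopic x0 f f' -> homotopic x0 g g' ->
  homotopic x0 (concat f g) (concat f' g').
Proof.
move=> [H [cH H0 H1 Hb]] [K [cK K0 K1 Kb]].
exists (fun y : 'rV[R]_n.+1 * R => if y.1 0 ord0 <= 2^-1
  then H (with_first y.1 (2 * y.1 0 ord0), y.2)
  else K (with_first y.1 (2 * y.1 0 ord0 - 1), y.2)).
have cfst0 : continuous (fun y : 'rV[R]_n.+1 * R => y.1 0 ord0) by cts.
split.
- apply: (within_paste (@closed_cylinder n.+1) cfst0).
  + apply: (@within_comp _ _ _ _ _ H
      (fun y : 'rV[R]_n.+1 * R => (with_first y.1 (2 * y.1 0 ord0), y.2)) cH).
      by cts.
    move=> y [[cy ty] hy]; split=> //=; apply: unit_cube_with_first => //.
    by have := first01 cy; lra.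
  + apply: (@within_comp _ _ _ _ _ K
      (fun y : 'rV[R]_n.+1 * R => (with_first y.1 (2 * y.1 0 ord0 - 1), y.2)) cK).
      by cts.
    move=> y [[cy ty] hy]; split=> //=; apply: unit_cube_with_first => //.
    by have := first01 cy; lra.
  + move=> y [cy]; rewrite /= in_itv /= => ty ->.
    rewrite mulfV ?pnatr_eq0// subrr Hb ?Kb//.
      by apply: boundary_first => //; left.
    by apply: boundary_first => //; right.
- move=> s cs /=; have := first01 cs; rewrite /concat; case: ifPn => hs h01.
    by rewrite H0//; apply: unit_cube_with_first => //; lra.
  by rewrite K0//; apply: unit_cube_with_first => //; lra.
- move=> s cs /=; have := first01 cs; rewrite /concat; case: ifPn => hs h01.
    by rewrite H1//; apply: unit_cube_with_first => //; lra.
  by rewrite K1//; apply: unit_cube_with_first => //; lra.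
- move=> s t bs t01 /=; have := first01 bs.1; case: ifPn => hs h01.
    apply: Hb => //; apply: boundary_with_first => //; first lra.
    by move=> [] e; rewrite e in hs *; [left|exfalso]; lra.
  apply: Kb => //; apply: boundary_with_first => //; first lra.
  by move=> [] e; rewrite e in hs *; [exfalso|right]; lra.
Qed.

Lemma reverse_homotopic n x0 (f g : 'rV[R]_n.+1 -> X) :
  homotopic x0 f g -> homotopic x0 (reverse f) (reverse g).
Proof.
move=> [H [cH H0 H1 Hb]].
exists (fun y : 'rV[R]_n.+1 * R => H (with_first y.1 (1 - y.1 0 ord0), y.2)).
have rev01 (s : 'rV[R]_n.+1) : unit_cube s ->
    unit_cube (with_first s (1 - s 0 ord0)).
  by move=> cs; apply: unit_cube_with_first => //; have := first01 cs; lra.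
split.
- apply: (@within_comp _ _ _ _ _ H
    (fun y : 'rV[R]_n.+1 * R => (with_first y.1 (1 - y.1 0 ord0), y.2)) cH).
    by cts.
  by move=> y [cy ty]; split=> //=; exact: rev01.
- by move=> s cs; rewrite H0//; exact: rev01.
- by move=> s cs; rewrite H1//; exact: rev01.
- move=> s t bs t01; apply: Hb => //=; have h01 := first01 bs.1.
  apply: boundary_with_first => //; first lra.
  by move=> [] ->; [right|left]; lra.
Qed.

(* Two reparametrizations of the first coordinate that agree at the endpoints, *)
(* with values in {0, 1} there, give homotopic maps.                           *)
Lemma reparam_homotopic n x0 (f g h : 'rV[R]_n.+1 -> X) (phi psi : R -> R) :
  spheroids x0 f -> continuous phi -> continuous psi ->
  (forall a, 0 <= a <= 1 -> 0 <= phi a <= 1) ->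
  (forall a, 0 <= a <= 1 -> 0 <= psi a <= 1) ->
  phi 0 = psi 0 -> phi 1 = psi 1 ->
  phi 0 = 0 \/ phi 0 = 1 -> phi 1 = 0 \/ phi 1 = 1 ->
  (forall s, unit_cube s -> g s = f (with_first s (phi (s 0 ord0)))) ->
  (forall s, unit_cube s -> h s = f (with_first s (psi (s 0 ord0)))) ->
  homotopic x0 g h.
Proof.
move=> [cf f0] cphi cpsi phi01 psi01 e0 e1 d0 d1 gE hE.
pose c (y : 'rV[R]_n.+1 * R) :=
  (1 - y.2) * phi (y.1 0 ord0) + y.2 * psi (y.1 0 ord0).
have cfst0 : continuous (fun y : 'rV[R]_n.+1 * R => y.1 0 ord0) by cts.
have c01 s t : unit_cube s -> 0 <= t <= 1 -> 0 <= c (s, t) <= 1.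
  move=> /first01 s01 t01; rewrite /c /=.
  by have := phi01 _ s01; have := psi01 _ s01; nra.
exists (fun y : 'rV[R]_n.+1 * R => f (with_first y.1 (c y))); split.
- apply: (@within_comp _ _ _ _ _ f (fun y : 'rV[R]_n.+1 * R => with_first y.1 (c y)) cf).
    by rewrite /c; cts.
  move=> [s t] [/= cs]; rewrite in_itv /= => t01.
  by apply: unit_cube_with_first => //; exact: c01.
- by move=> s cs; rewrite /c /= subr0 mul1r mul0r addr0 gE.
- by move=> s cs; rewrite /c /= subrr mul1r mul0r add0r hE.
- move=> s t bs t01; apply: f0; apply: boundary_with_first => //=.
    exact: c01 bs.1 t01.
  rewrite /c /= => -[] ->; rewrite -?e0 -?e1 -mulrDl subrK mul1r.
    exact: d0.
  exact: d1.
Qed.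

Lemma eq_homotopic n x0 (f g : 'rV[R]_n.+1 -> X) : spheroids x0 f ->
  (forall s, unit_cube s -> f s = g s) -> homotopic x0 f g.
Proof.
move=> Sf fg; have cid : continuous (@id R) by cts.
apply: (reparam_homotopic Sf cid cid) => //; [by left|by right| |] => s cs;
  by rewrite with_first_id// fg.
Qed.

Lemma concat_const_r n x0 (f : 'rV[R]_n.+1 -> X) : spheroids x0 f ->
  homotopic x0 (concat f (fun=> x0)) f.
Proof.
move=> Sf; have cid : continuous (@id R) by cts.
pose phi (a : R) := Num.min (2 * a + 0) (0 * a + 1).
have cphi : continuous phi by rewrite /phi; cts.
apply: (reparam_homotopic Sf cphi cid) => //; rewrite /phi.
- by move=> a a01; rewrite /Num.min; case: ifP; lra.
- by rewrite /Num.min; case: ifP; lra.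
- by rewrite /Num.min; case: ifP; lra.
- by left; rewrite /Num.min; case: ifP; lra.
- by right; rewrite /Num.min; case: ifP; lra.
- move=> s cs; have s01 := first01 cs; rewrite /concat addr0 mul0r add0r /Num.min.
  case: ifPn => h; case: ifPn => h'.
  + by [].
  + by congr (f (with_first _ _)); lra.
  + by exfalso; lra.
  + by rewrite Sf.2//; apply: boundary_first => //; right.
- by move=> s cs; rewrite with_first_id.
Qed.

Lemma concat_const_l n x0 (f : 'rV[R]_n.+1 -> X) : spheroids x0 f ->
  homotopic x0 (concat (fun=> x0) f) f.
Proof.
move=> Sf; have cid : continuous (@id R) by cts.
pose phi (a : R) := Num.max (2 * a - 1) (0 * a + 0).
have cphi : continuous phi by rewrite /phi; cts.
apply: (reparam_homotopic Sf cphi cid) => //; rewrite /phi.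
- by move=> a a01; rewrite /Num.max; case: ifP; lra.
- by rewrite /Num.max; case: ifP; lra.
- by rewrite /Num.max; case: ifP; lra.
- by left; rewrite /Num.max; case: ifP; lra.
- by right; rewrite /Num.max; case: ifP; lra.
- move=> s cs; have s01 := first01 cs; rewrite /concat mul0r add0r /Num.max.
  case: ifPn => h; case: ifPn => h'.
  + by rewrite Sf.2//; apply: boundary_first => //; left.
  + by rewrite Sf.2//; apply: boundary_first => //; left; lra.
  + by exfalso; lra.
  + by [].
- by move=> s cs; rewrite with_first_id.
Qed.

Lemma concat_reverse_r n x0 (f : 'rV[R]_n.+1 -> X) : spheroids x0 f ->
  homotopic x0 (concat f (reverse f)) (fun=> x0).
Proof.
move=> Sf; have cz : continuous (fun _ : R => 0 : R) by cts.
pose phi (a : R) := Num.min (2 * a + 0) (- 2 * a + 2).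
have cphi : continuous phi by rewrite /phi; cts.
apply: (reparam_homotopic Sf cphi cz) => //; rewrite /phi.
- by move=> a a01; rewrite /Num.min; case: ifP; lra.
- by move=> a a01; lra.
- by rewrite /Num.min; case: ifP; lra.
- by rewrite /Num.min; case: ifP; lra.
- by left; rewrite /Num.min; case: ifP; lra.
- by left; rewrite /Num.min; case: ifP; lra.
- move=> s cs; have s01 := first01 cs.
  rewrite /concat /reverse with_firstK with_first0 /Num.min.
  by case: ifPn => h; case: ifPn => h'; congr (f (with_first _ _)); lra.
- by move=> s cs; rewrite Sf.2//; apply: boundary_first => //; left.
Qed.

Lemma concat_reverse_l n x0 (f : 'rV[R]_n.+1 -> X) : spheroids x0 f ->
  homotopic x0 (concat (reverse f) f) (fun=> x0).
Proof.
move=> Sf; have cz : continuous (fun _ : R => 1 : R) by cts.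
pose phi (a : R) := Num.max (2 * a - 1) (- 2 * a + 1).
have cphi : continuous phi by rewrite /phi; cts.
apply: (reparam_homotopic Sf cphi cz) => //; rewrite /phi.
- by move=> a a01; rewrite /Num.max; case: ifP; lra.
- by move=> a a01; lra.
- by rewrite /Num.max; case: ifP; lra.
- by rewrite /Num.max; case: ifP; lra.
- by right; rewrite /Num.max; case: ifP; lra.
- by right; rewrite /Num.max; case: ifP; lra.
- move=> s cs; have s01 := first01 cs.
  rewrite /concat /reverse with_firstK with_first0 /Num.max.
  by case: ifPn => h; case: ifPn => h'; congr (f (with_first _ _)); lra.
- by move=> s cs; rewrite Sf.2//; apply: boundary_first => //; right.
Qed.

Lemma concatA_homotopic n x0 (f g h : 'rV[R]_n.+1 -> X) :
  spheroids x0 f -> spheroids x0 g -> spheroids x0 h ->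
  homotopic x0 (concat f (concat g h)) (concat (concat f g) h).
Proof.
move=> Sf Sg Sh; have Sfgh := concat_spheroid Sf (concat_spheroid Sg Sh).
apply: homotopic_sym; have cid : continuous (@id R) by cts.
pose phi (a : R) :=
  Num.min (Num.min (2 * a + 0) (1 * a + 4^-1)) (2^-1 * a + 2^-1).
have cphi : continuous phi by rewrite /phi; cts.
apply: (reparam_homotopic Sfgh cphi cid) => //.
- by move=> a a01; rewrite /phi /Num.min; do 2 case: ifP; lra.
- by rewrite /phi /Num.min; do 2 case: ifP; lra.
- by rewrite /phi /Num.min; do 2 case: ifP; lra.
- by left; rewrite /phi /Num.min; do 2 case: ifP; lra.
- by right; rewrite /phi /Num.min; do 2 case: ifP; lra.
- move=> s cs; have s01 := first01 cs.
  rewrite /concat !with_firstK !with_first0.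
  case: (lerP (s 0 ord0) 2^-1) => h1; last first.
    have -> : phi (s 0 ord0) = 2^-1 * s 0 ord0 + 2^-1.
      by rewrite /phi /Num.min; do 2 case: ifP; lra.
    do 2 (rewrite ifF; last by apply/negbTE; rewrite -ltNge; lra).
    by congr (h (with_first _ _)); lra.
  case: (lerP (2 * s 0 ord0) 2^-1) => h2.
    have -> : phi (s 0 ord0) = 2 * s 0 ord0.
      by rewrite /phi /Num.min; do 2 case: ifP; lra.
    by rewrite ifT; last lra.
  have -> : phi (s 0 ord0) = s 0 ord0 + 4^-1.
    by rewrite /phi /Num.min; do 2 case: ifP; lra.
  rewrite ifF; last by apply/negbTE; rewrite -ltNge; lra.
  by rewrite ifT; [congr (g (with_first _ _))|]; lra.
- by move=> s cs; rewrite with_first_id.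
Qed.

End Spheroids.

Section HomotopyGroup.
Variables (R : realType) (X : topologicalType).

Definition spheroid n (x0 : X) : Type := set_type (@spheroids R X n x0).

HB.instance Definition _ n x0 := Choice.on (@spheroid n x0).

Definition spheroid_homotopic n x0 (f g : @spheroid n x0) : bool :=
  `[< homotopic x0 (val f) (val g) >].

Lemma spheroidP n x0 (f : @spheroid n x0) : spheroids x0 (val f).
Proof. exact: set_mem (valP f). Qed.

Definition mk_spheroid n x0 (f : 'rV[R]_n -> X) (Sf : spheroids x0 f) :
  spheroid n x0 := exist _ f (mem_set Sf).

Fact spheroid_homotopic_refl n x0 : reflexive (@spheroid_homotopic n x0).
Proof. by move=> f; apply/asboolP/homotopic_refl/spheroidP. Qed.

Fact spheroid_homotopic_sym n x0 : symmetric (@spheroid_homotopic n x0).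
Proof. by move=> f g; apply/asboolP/asboolP; exact: homotopic_sym. Qed.

Fact spheroid_homotopic_trans n x0 : transitive (@spheroid_homotopic n x0).
Proof.
by move=> g f h /asboolP fg /asboolP gh; apply/asboolP; exact: homotopic_trans gh.
Qed.

Canonical spheroid_equiv n x0 := EquivRel (@spheroid_homotopic n x0)
  (@spheroid_homotopic_refl n x0) (@spheroid_homotopic_sym n x0)
  (@spheroid_homotopic_trans n x0).

Definition homotopy_group n x0 : Type := {eq_quot (@spheroid_equiv n x0)}.

HB.instance Definition _ n x0 := Choice.on (@homotopy_group n x0).
HB.instance Definition _ n x0 := Quotient.on (@homotopy_group n x0).

Lemma homotopy_classP n x0 (f g : spheroid n x0) :
  \pi_(homotopy_group n x0) f = \pi_(homotopy_group n x0) g <->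
  homotopic x0 (val f) (val g).
Proof. by split=> [/eqmodP/asboolP|h]; last apply/eqmodP/asboolP. Qed.

Section GroupStructure.
Variables (n : nat) (x0 : X).
Local Notation S := (spheroid n.+1 x0).
Local Notation G := (homotopy_group n.+1 x0).
Implicit Types (f g : S) (a b c : G).

Definition spheroid_mul f g : S :=
  mk_spheroid (concat_spheroid (spheroidP f) (spheroidP g)).

Definition spheroid_inv f : S := mk_spheroid (reverse_spheroid (spheroidP f)).

Definition spheroid_one : S := mk_spheroid (@const_spheroid R X n.+1 x0).

Definition homotopy_mul a b : G := \pi_G (spheroid_mul (repr a) (repr b)).
Definition homotopy_inv a : G := \pi_G (spheroid_inv (repr a)).
Definition homotopy_one : G := \pi_G spheroid_one.

Lemma homotopic_repr f : homotopic x0 (val (repr (\pi_G f))) (val f).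
Proof. by apply/homotopy_classP; rewrite reprK. Qed.

Lemma homotopy_mulE f g :
  homotopy_mul (\pi_G f) (\pi_G g) = \pi_G (spheroid_mul f g).
Proof.
by apply/homotopy_classP; apply: concat_homotopic; exact: homotopic_repr.
Qed.

Lemma homotopy_invE f : homotopy_inv (\pi_G f) = \pi_G (spheroid_inv f).
Proof.
by apply/homotopy_classP; apply: reverse_homotopic; exact: homotopic_repr.
Qed.

Fact homotopy_mulA : associative homotopy_mul.
Proof.
move=> a b c; rewrite -[a]reprK -[b]reprK -[c]reprK.
rewrite (homotopy_mulE (repr b)) (homotopy_mulE (repr a) (repr b)) !homotopy_mulE.
apply/homotopy_classP.
exact: (concatA_homotopic (spheroidP (repr a)) (spheroidP (repr b)) (spheroidP (repr c))).
Qed.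

Fact homotopy_1mul : left_id homotopy_one homotopy_mul.
Proof.
move=> a; rewrite -[a]reprK homotopy_mulE; apply/homotopy_classP.
by apply: concat_const_l; exact: spheroidP.
Qed.

Fact homotopy_mul1 : right_id homotopy_one homotopy_mul.
Proof.
move=> a; rewrite -[a]reprK homotopy_mulE; apply/homotopy_classP.
by apply: concat_const_r; exact: spheroidP.
Qed.

Fact homotopy_Vmul : left_inverse homotopy_one homotopy_inv homotopy_mul.
Proof.
move=> a; rewrite -[a]reprK homotopy_invE homotopy_mulE; apply/homotopy_classP.
by apply: concat_reverse_l; exact: spheroidP.
Qed.

Fact homotopy_mulV : right_inverse homotopy_one homotopy_inv homotopy_mul.
Proof.
move=> a; rewrite -[a]reprK homotopy_invE homotopy_mulE; apply/homotopy_classP.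
by apply: concat_reverse_r; exact: spheroidP.
Qed.

HB.instance Definition _ := isGroup.Build G homotopy_mulA homotopy_1mul
  homotopy_mul1 homotopy_Vmul homotopy_mulV.

End GroupStructure.

End HomotopyGroup.

Arguments homotopy_group R {X} n x0.

Definition isomorphic (G H : groupType) : Prop :=
  exists f : {multiplicative G -> H}, bijective f.

Section ConfigurationSpaces.
Variable R : realType.
Implicit Types m n k : nat.

Definition inner n (u v : 'rV[R]_n) : R := \sum_i u 0 i * v 0 i.

Definition enorm n (u : 'rV[R]_n) : R := Num.sqrt (inner u u).

Definition sphere m : set 'rV[R]_m.+1 := [set x | enorm x = 1].

(* A tuple (p_1, ..., p_n) of vectors is the matrix whose rows are the p_i;   *)
(* 'M[R]_(n, m.+1) carries the product topology. The rows indexed by I are    *)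
(* tested as a family, so repeated points are linearly dependent.             *)
Definition confW k n m : set 'M[R]_(n, m.+1) :=
  [set p | (forall i, sphere (row i p)) /\
     forall I : {set 'I_n}, #|I| = k -> free [seq row i p | i in I]].

(* k is the number of points spanned together with x, so the set Q_{k-1,n} of *)
(* a point of W_{k,n} is [confQ k.-1 p].                                      *)
Definition confQ k n m (p : 'M[R]_(n, m.+1)) : set 'rV[R]_m.+1 :=
  \bigcup_(I in [set I : {set 'I_n} | #|I| = k])
    [set x | sphere x /\ ~~ free (x :: [seq row i p | i in I])].

(* V_{m,n}: orthonormal n-frames in R^m. *)
Definition stiefel m n : set 'M[R]_(n, m) :=
  [set v | forall i j, inner (row i v) (row j v) = (i == j)%:R].

(* 0-based: e_{i+1} in R^N (and 0 when N <= i). *)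
Definition basis_vec N (i : nat) : 'rV[R]_N := \row_j (j == i :> nat)%:R.

(* b_k *)
Definition frame k N : 'M[R]_(k, N) := \matrix_(i < k) basis_vec N i.

Definition frame_sum k N : 'rV[R]_N := \sum_(i < k) basis_vec N i.

(* \tilde b_k *)
Definition frame_tilde k N : 'M[R]_(k.+1, N) :=
  \matrix_(i < k.+1)
    if (i < k)%N then basis_vec N i
    else (enorm (frame_sum k N))^-1 *: frame_sum k N.

Arguments sphere : clear implicits.
Arguments confW : clear implicits.
Arguments stiefel : clear implicits.

Lemma free_familyP (I : finType) (N : nat) (v : I -> 'rV[R]_N) (A : {set I}) :
  (forall c : I -> R, \sum_(i in A) c i *: v i = 0 ->
     forall i, i \in A -> c i = 0) ->
  free [seq v i | i in A].
Proof.
move=> h; pose X := image_tuple v (mem A).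
suff : free X by [].
apply/freeP => k kX i.
case: (pickP (mem A)) => [a0 a0A|A0]; last by have := A0 (enum_val i); rewrite /= (enum_valP i).
pose c j := k (enum_rank_in a0A j).
have cE j : c (enum_val j) = k j by rewrite /c enum_valK_in.
rewrite -cE; apply: h; last exact: enum_valP.
rewrite big_enum_val -[RHS]kX; apply: eq_bigr => j _.
by rewrite cE nth_image.
Qed.

Lemma basis_vecE N i j : basis_vec N i 0 j = (j == i :> nat)%:R.
Proof. by rewrite mxE. Qed.

Lemma row_frame k N i : row i (frame k N) = basis_vec N i.
Proof. by rewrite rowK. Qed.

Lemma inner_basis_vec N (i j : 'I_N) :
  inner (basis_vec N i) (basis_vec N j) = (i == j)%:R.
Proof.
rewrite /inner (bigD1 i)//= !basis_vecE eqxx mul1r big1 ?addr0// => l li.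
by rewrite !basis_vecE (_ : (l == i :> nat) = false) ?mul0r//; exact/negbTE.
Qed.

Lemma sphere_basis_vec m (i : 'I_m.+1) : sphere m (basis_vec m.+1 i).
Proof. by rewrite /sphere/= /enorm inner_basis_vec eqxx sqrtr1. Qed.

Lemma sum_basis_vec k N (A : {set 'I_k}) (c : 'I_k -> R) (j : 'I_k)
    (jN : (j < N)%N) : j \in A ->
  (\sum_(i in A) c i *: basis_vec N i) 0 (Ordinal jN) = c j.
Proof.
move=> jA; rewrite summxE (bigD1 j)//= mxE basis_vecE eqxx mulr1 big1 ?addr0//.
move=> i /andP[_ ij]; rewrite mxE basis_vecE /= eq_sym.
by rewrite (_ : (i == j :> nat) = false) ?mulr0//; exact/negbTE.
Qed.

Lemma free_frame k N (A : {set 'I_k}) : (k <= N)%N ->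
  free [seq row i (frame k N) | i in A].
Proof.
move=> kN; apply: free_familyP => c c0 j jA.
have jN : (j < N)%N := leq_trans (ltn_ord j) kN.
rewrite -(sum_basis_vec c jN jA).
have -> : \sum_(i in A) c i *: basis_vec N i = 0.
  by rewrite -[RHS]c0; apply: eq_bigr => i _; rewrite row_frame.
by rewrite !mxE.
Qed.

Lemma frame_confW k n m : (n <= m.+1)%N -> confW k n m (frame n m.+1).
Proof.
move=> nm; split=> [i|I _]; last exact: free_frame.
rewrite row_frame.
exact: (sphere_basis_vec (Ordinal (leq_trans (ltn_ord i) nm))).
Qed.

Lemma frame_stiefel m n : (n <= m)%N -> stiefel m n (frame n m).
Proof.
move=> nm i j; rewrite !row_frame.
exact: (inner_basis_vec (widen_ord nm i) (widen_ord nm j)).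
Qed.

Lemma basis_vec_confQ k m :
  (sphere m `\` confQ k (frame m m.+1)) (basis_vec m.+1 m).
Proof.
split; first exact: (sphere_basis_vec (@ord_max m)).
move=> [I _ [_ /negP]]; apply; rewrite free_cons free_frame// andbT.
apply/negP => /(@coord_span _ _ _ (image_tuple _ _)) /(congr1 (fun v : 'rV_m.+1 => v 0 ord_max)).
rewrite basis_vecE eqxx summxE big1 => [/eqP|i _]; first by rewrite oner_eq0.
rewrite mxE nth_image row_frame basis_vecE /=.
by rewrite gtn_eqF ?mulr0.
Qed.

Lemma frame_sumE k N (j : 'I_N) : frame_sum k N 0 j = (j < k)%:R.
Proof.
rewrite summxE; case: ltnP => jk.
  rewrite (bigD1 (Ordinal jk))//= basis_vecE eqxx big1 ?addr0// => i ij.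
  rewrite basis_vecE eq_sym (_ : (i == j :> nat) = false)//.
  by apply/negbTE; apply: contraNneq ij => ij; apply/eqP/val_inj.
rewrite big1// => i _; rewrite basis_vecE gtn_eqF//.
exact: leq_trans (ltn_ord i) jk.
Qed.

Lemma inner_ge0 N (u : 'rV[R]_N) : 0 <= inner u u.
Proof. by apply: sumr_ge0 => i _; rewrite -expr2 sqr_ge0. Qed.

Lemma enormZ N (a : R) (u : 'rV[R]_N) : enorm (a *: u) = `|a| * enorm u.
Proof.
rewrite /enorm (_ : inner _ _ = a ^+ 2 * inner u u).
  by rewrite sqrtrM ?sqr_ge0// sqrtr_sqr.
by rewrite /inner big_distrr /=; apply: eq_bigr => i _; rewrite !mxE; ring.
Qed.

Lemma enorm_frame_sum_gt0 m : 0 < enorm (frame_sum m.+1 m.+1).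
Proof.
rewrite sqrtr_gt0 /inner (bigD1 ord0)//= ltr_wpDr ?frame_sumE//.
  by apply: sumr_ge0 => i _; rewrite -expr2 sqr_ge0.
by rewrite mulr1.
Qed.

Lemma frame_tilde_confW m : confW m.+1 m.+2 m (frame_tilde m.+1 m.+1).
Proof.
have s0 := enorm_frame_sum_gt0 m.
split=> [i|I cI].
  rewrite rowK; case: ifPn => hi; first exact: (sphere_basis_vec (Ordinal hi)).
  by rewrite /sphere/= enormZ ger0_norm ?invr_ge0 ?ltW// mulVf// gt_eqF.
apply: free_familyP => c c0.
have cj (j : 'I_m.+1) : (if widen_ord (leqnSn _) j \in I
      then c (widen_ord (leqnSn _) j) else 0) +
    (if ord_max \in I then c ord_max else 0) / enorm (frame_sum m.+1 m.+1) = 0.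
  transitivity ((\sum_(i in I) c i *: row i (frame_tilde m.+1 m.+1)) 0 j); last first.
    by rewrite c0 mxE.
  rewrite summxE big_mkcond big_ord_recr /=; congr (_ + _).
    rewrite (bigD1 j)//= big1 ?addr0 => [|i ij].
      by case: ifP => // _; rewrite mxE rowK /= ltn_ord basis_vecE eqxx mulr1.
    case: ifP => // _; rewrite mxE rowK /= ltn_ord basis_vecE eq_sym.
    by rewrite (_ : (i == j :> nat) = false) ?mulr0//; exact/negbTE.
  case: ifP => _; last by rewrite mul0r.
  by rewrite mxE rowK /= ltnn mxE frame_sumE ltn_ord mulr1.
have cmax : (if ord_max \in I then c ord_max else 0) = 0.
  case: ifP => // maxI.
  have [j jI] : exists j, j \notin I.
    apply/existsP; rewrite -negb_forall; apply/negP => /forallP allI.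
    have : #|I| = m.+2 by rewrite -[RHS]card_ord; apply: eq_card => i; rewrite allI.
    by rewrite cI => /eqP; rewrite ltn_eqF.
  have jm : (j < m.+1)%N.
    rewrite ltn_neqAle -ltnS ltn_ord andbT; apply: contraNneq jI => jm.
    by rewrite (_ : j = ord_max)//; exact: val_inj.
  have := cj (Ordinal jm); rewrite maxI (_ : widen_ord _ _ = j); last exact: val_inj.
  rewrite (negbTE jI) add0r => /eqP; rewrite mulf_eq0 invr_eq0 (gt_eqF s0) orbF.
  by move/eqP.
move=> i iI; have [im|im] := ltnP i m.+1.
  have := cj (Ordinal im); rewrite cmax mul0r addr0.
  by rewrite (_ : widen_ord _ _ = i) ?iI//; exact: val_inj.
have iE : i = ord_max by apply/val_inj/eqP; rewrite eqn_leq im -ltnS ltn_ord.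
by move: cmax; rewrite -iE iI.
Qed.

End ConfigurationSpaces.

Arguments sphere : clear implicits.
Arguments confW : clear implicits.
Arguments stiefel : clear implicits.
Arguments frame : clear implicits.
Arguments frame_tilde : clear implicits.
Arguments basis_vec : clear implicits.

Definition base_point (T : Type) (A : set T) (x : T) (Ax : A x) : A :=
  exist _ x (mem_set Ax).

Section BasePoints.
Variable R : realType.
Implicit Types m n k : nat.

Definition b_confW k n m (h : (n <= m.+1)%N) : confW R k n m :=
  base_point (frame_confW R k h).

Definition b_stiefel m n (h : (n <= m)%N) : stiefel R m n :=
  base_point (frame_stiefel R h).

Definition b_tilde_confW m : confW R m.+1 m.+2 m :=
  base_point (frame_tilde_confW R m).

Definition e_confQ k m : sphere R m `\` confQ k (frame R m m.+1) :=
  base_point (basis_vec_confQ R k m).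

End BasePoints.

Arguments b_confW R k {n m} h.
Arguments b_stiefel R {m n} h.

(* Main.v *)
From HB Require Import structures.
Require Import Defs.
From mathcomp Require Import all_boot all_order all_algebra.
From mathcomp Require Import all_classical all_reals all_analysis.
From mathcomp Require Import generic_quotient ring lra.
Import Order.TTheory GRing.Theory Num.Theory.
Import numFieldNormedType.Exports.

Set Implicit Arguments.
Unset Strict Implicit.
Unset Printing Implicit Defensive.

(** Each space is compared with a space of linearly independent families.

    Part (a): [confW R n n m] is the set of independent families of [n] unit
    vectors, and the Gram-Schmidt process deforms it onto the orthonormal ones.
    The process is run one row at a time: [partial_frames R n m.+1 k] consists of
    the families whose first [k] vectors are orthonormal, and subtracting a growing
    multiple of the projection from the next vector, then normalizing, is a strong
    deformation retraction onto the following set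
    ([isomorphic_retract], [isomorphic_partial_frames]). Every stage fixes the
    standard frame.

    Parts (b) and (c): dropping the last point maps a configuration to one of the
    kind treated in part (a), and the fibre over [p] consists of the points of the
    sphere outside [confQ _ p] ([confW_snoc]).

    In part (b), [m] independent vectors [p] in dimension [m] + 1 have a normal
    vector that depends continuously on [p] (the generalized cross product). With
    it [p] becomes a basis, and the linear maps between these bases carry the
    fibres onto one another; this gives a homeomorphism with the product of the
    base and the fibre over the standard frame, and homotopy groups commute with
    products ([isomorphic_homotopy_prod]).

    In part (c), [p] is itself a basis, and the fibre consists of the points with
    no zero coordinate: a union of open orthants of the sphere. A spheroid never
    leaves the orthant of its base point, which is contractible, so the last point
    does not contribute ([isomorphic_confW_tilde]). *)

Local Open Scope classical_set_scope.
Local Open Scope ring_scope.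
Local Open Scope quotient_scope.

(** * Maps into subspaces *)

Section Subspaces.
Variables (E : topologicalType) (A : set E).

(** The type [A] has the initial topology of its inclusion into [E]. *)
Lemma cvg_set_type (T : Type) (F : set_system T) (FF : Filter F)
    (f : T -> A) (x : A) :
  (fun t => val (f t)) @ F --> val x -> f @ F --> x.
Proof.
move=> cf U /=; rewrite nbhs_simpl /= nbhsE => -[V [[W oW WV] Vx] VU].
have : nbhs (val x) W by apply: open_nbhs_nbhs; split=> //; move: Vx; rewrite -WV.
move=> /cf; rewrite /= nbhs_simpl /=; apply: filterS => t Wt; apply: VU.
by rewrite -WV.
Qed.

Lemma val_set_continuous : continuous (fun a : A => val a).
Proof. exact: initial_continuous. Qed.

(** [A] as a type is a subtype, so a map into it carries membership proofs; [into]
    turns a map that takes values in [A] on some domain into a map to the type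
    [A], at the price of a default value [a] off that domain. *)
Definition into (a : A) (y : E) : A := insubd a y.

Lemma val_into a y : A y -> val (into a y) = y.
Proof. by move=> Ay; rewrite val_insubd mem_set. Qed.

Lemma set_typeP (a : A) : A (val a).
Proof. exact: set_mem (valP a). Qed.

Lemma within_into (T : topologicalType) (D : set T) (f : T -> E) a :
  (forall t, D t -> A (f t)) -> {within D, continuous f} ->
  {within D, continuous (fun t => into a (f t))}.
Proof.
move=> DA /subspace_continuousP cf; apply/subspace_continuousP => t Dt.
apply: cvg_set_type; rewrite val_into; last exact: DA.
apply: cvg_trans (cf t Dt); apply: near_eq_cvg; rewrite near_withinE.
by apply: nearW => s Ds; rewrite val_into//; exact: DA.
Qed.

Lemma into_continuous (T : topologicalType) (f : T -> E) a :
  (forall t, A (f t)) -> continuous f -> continuous (fun t => into a (f t)).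
Proof.
move=> DA cf t; apply: cvg_set_type; rewrite val_into//.
by apply: cvg_trans (cf t); apply: near_eq_cvg; apply: nearW => s; rewrite val_into.
Qed.

End Subspaces.

(** * Homotopy groups: functoriality, products, equivalences *)

Section InducedMap.
Variables (R : realType) (X Y : topologicalType).

Lemma within_continuous_comp (T : topologicalType) (D : set T) (f : T -> X)
    (g : X -> Y) :
  {within D, continuous f} -> continuous g -> {within D, continuous (g \o f)}.
Proof.
move=> /subspace_continuousP cf cg; apply/subspace_continuousP => t Dt.
by apply: (cvg_comp _ _ (cf t Dt)); exact: cg.
Qed.

Variables (F : X -> Y) (x0 : X) (y0 : Y).
Hypotheses (cF : continuous F) (F0 : F x0 = y0).

Lemma spheroid_comp n (f : 'rV[R]_n -> X) :
  spheroids x0 f -> spheroids y0 (F \o f).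
Proof.
move=> [cf f0]; split; first exact: within_continuous_comp.
by move=> s bs; rewrite /= f0.
Qed.

Lemma homotopic_comp n (f g : 'rV[R]_n -> X) :
  homotopic x0 f g -> homotopic y0 (F \o f) (F \o g).
Proof.
move=> [H [cH H0 H1 Hb]]; exists (F \o H); split=> /=.
- exact: within_continuous_comp.
- by move=> s cs; rewrite H0.
- by move=> s cs; rewrite H1.
- by move=> s t bs t01; rewrite Hb.
Qed.

(** The homomorphism that [F] induces, defined on a representative of the class
    because the homotopy group is a quotient of the spheroids. *)
Definition induced n (a : homotopy_group R n x0) : homotopy_group R n y0 :=
  \pi_(homotopy_group R n y0) (mk_spheroid (spheroid_comp (spheroidP (repr a)))).

Lemma inducedE n (f : @spheroid R X n x0) :
  induced (\pi_(homotopy_group R n x0) f) =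
  \pi_(homotopy_group R n y0) (mk_spheroid (spheroid_comp (spheroidP f))).
Proof.
by apply/homotopy_classP; apply: homotopic_comp; apply/homotopy_classP; rewrite reprK.
Qed.

(** Composition with [F] commutes with concatenation on the nose, not only up to
    homotopy. *)
Lemma inducedM q : {morph @induced q.+1 : a b / (a * b)%g}.
Proof.
move=> a b; rewrite -[a]reprK -[b]reprK.
rewrite [X in induced X]homotopy_mulE !inducedE.
rewrite [RHS]homotopy_mulE.
congr \pi_(_); apply/val_inj/funext => s /=.
by rewrite /concat /=; case: ifP.
Qed.

End InducedMap.

Section Isomorphic.
Local Open Scope group_scope.

Lemma isomorphic_of (G H : groupType) (f : G -> H) :
  {morph f : x y / x * y} -> bijective f -> isomorphic G H.
Proof.
move=> fM bf.
pose m := isMultiplicative.Build G H f fM.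
pose M : {multiplicative G -> H} := HB.pack f m.
by exists M.
Qed.

Lemma isomorphic_trans (G H K : groupType) :
  isomorphic G H -> isomorphic H K -> isomorphic G K.
Proof.
move=> [f bf] [g bg]; apply: (@isomorphic_of _ _ (g \o f)); last exact: bij_comp.
by move=> x y /=; rewrite !gmulfM.
Qed.

Lemma isomorphic_refl (G : groupType) : isomorphic G G.
Proof. by apply: (@isomorphic_of _ _ id) => //; exists id. Qed.

Lemma isomorphic_prod (G H G' H' : groupType) :
  isomorphic G G' -> isomorphic H H' -> isomorphic (G * H)%type (G' * H')%type.
Proof.
move=> [f [f' fK f'K]] [g [g' gK g'K]].
apply: (@isomorphic_of _ _ (fun x => (f x.1, g x.2))).
  by move=> x y; congr pair; exact: gmulfM.
exists (fun x => (f' x.1, g' x.2)) => -[a b] /=; by rewrite ?fK ?gK ?f'K ?g'K.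
Qed.

End Isomorphic.

Section HomotopyEquivalence.
Variables (R : realType).

(** The homotopies are asked of each spheroid and not of the spaces, so that [F]
    may forget path components that do not contain the base point. *)
Lemma isomorphic_homotopy_group (X Y : topologicalType) (x0 : X) (y0 : Y)
    (F : X -> Y) (G : Y -> X) q :
  continuous F -> continuous G -> F x0 = y0 -> G y0 = x0 ->
  (forall f : 'rV[R]_q.+1 -> X, spheroids x0 f -> homotopic x0 (G \o F \o f) f) ->
  (forall g : 'rV[R]_q.+1 -> Y, spheroids y0 g -> homotopic y0 (F \o G \o g) g) ->
  isomorphic (homotopy_group R q.+1 x0) (homotopy_group R q.+1 y0).
Proof.
move=> cF cG F0 G0 hX hY.
apply: (@isomorphic_of _ _ (@induced R _ _ F x0 y0 cF F0 q.+1)).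
  exact: inducedM.
exists (@induced R _ _ G y0 x0 cG G0 q.+1) => a; rewrite -[RHS]reprK inducedE;
  apply/homotopy_classP.
- exact: hX (spheroidP _).
- exact: hY (spheroidP _).
Qed.

Lemma isomorphic_homeo (X Y : topologicalType) (x0 : X) (y0 : Y)
    (F : X -> Y) (G : Y -> X) q :
  continuous F -> continuous G -> cancel F G -> cancel G F -> F x0 = y0 ->
  isomorphic (homotopy_group R q.+1 x0) (homotopy_group R q.+1 y0).
Proof.
move=> cF cG FK GK F0.
apply: (isomorphic_homotopy_group cF cG F0); first by rewrite -F0 FK.
- move=> f Sf; rewrite (_ : _ \o f = f); first exact: homotopic_refl.
  by apply/funext => s /=; rewrite FK.
- move=> f Sf; rewrite (_ : _ \o f = f); first exact: homotopic_refl.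
  by apply/funext => s /=; rewrite GK.
Qed.

(** Spheroids of a product, and homotopies between them, are pairs. *)
Lemma isomorphic_homotopy_prod (Y Z : topologicalType) (y0 : Y) (z0 : Z) q :
  isomorphic (homotopy_group R q.+1 (y0, z0))
    (homotopy_group R q.+1 y0 * homotopy_group R q.+1 z0)%type.
Proof.
have c1 := @cts_fst Y Z; have c2 := @cts_snd Y Z.
pose i1 := @induced R _ _ fst (y0, z0) y0 c1 erefl q.+1.
pose i2 := @induced R _ _ snd (y0, z0) z0 c2 erefl q.+1.
apply: (@isomorphic_of _ _ (fun a => (i1 a, i2 a))).
  by move=> a b; rewrite /i1 /i2 !inducedM.
have SP (f : 'rV[R]_q.+1 -> Y) (g : 'rV[R]_q.+1 -> Z) :
    spheroids y0 f -> spheroids z0 g ->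
    spheroids (y0, z0) (fun s => (f s, g s)).
  move=> [/subspace_continuousP cf f0] [/subspace_continuousP cg g0]; split.
    by apply/subspace_continuousP => s cs; apply: cvg_pair; [exact: cf|exact: cg].
  by move=> s bs; rewrite f0 ?g0.
have HP (f f' : 'rV[R]_q.+1 -> Y) (g g' : 'rV[R]_q.+1 -> Z) :
    homotopic y0 f f' -> homotopic z0 g g' ->
    homotopic (y0, z0) (fun s => (f s, g s)) (fun s => (f' s, g' s)).
  move=> [H [/subspace_continuousP cH H0 H1 Hb]].
  move=> [K [/subspace_continuousP cK K0 K1 Kb]].
  exists (fun y => (H y, K y)); split.
  - by apply/subspace_continuousP => s cs; apply: cvg_pair; [exact: cH|exact: cK].
  - by move=> s cs; rewrite H0 ?K0.
  - by move=> s cs; rewrite H1 ?K1.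
  - by move=> s t bs t01; rewrite Hb ?Kb.
exists (fun p => \pi_(homotopy_group R q.+1 (y0, z0))
  (mk_spheroid (SP _ _ (spheroidP (repr p.1)) (spheroidP (repr p.2))))).
- move=> a; rewrite -[RHS]reprK; apply/homotopy_classP => /=.
  have h1 : homotopic y0 (val (repr (i1 a))) (fst \o val (repr a)) := homotopic_repr _.
  have h2 : homotopic z0 (val (repr (i2 a))) (snd \o val (repr a)) := homotopic_repr _.
  have e : (fun s => ((fst \o val (repr a)) s, (snd \o val (repr a)) s)) =
      val (repr a) by apply/funext => s /=; case: (sval _ s).
  by have := HP _ _ _ _ h1 h2; rewrite e.
- move=> [a b]; rewrite /i1 /i2 !inducedE -[in RHS](reprK a) -[in RHS](reprK b).
  congr pair; apply/homotopy_classP => /=; exact: homotopic_refl (spheroidP _).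
Qed.

(** Continuity of the track of a spheroid under a deformation [h] of the ambient
    space; [h] may be discontinuous off the image of the cylinder. *)
Lemma within_cylinder (E : topologicalType) (A : set E) n (f : 'rV[R]_n -> A)
    (h : E * R -> E) :
  {within @unit_cube R n, continuous f} ->
  (forall s t, unit_cube s -> 0 <= t <= 1 ->
    {for (val (f s), t), continuous h}) ->
  {within @unit_cube R n `*` `[0, 1],
    continuous (fun y => h (val (f y.1), y.2))}.
Proof.
move=> cf ch; apply/subspace_continuousP => -[s t] [/= cs].
rewrite in_itv /= => t01.
apply: (@cvg_comp _ _ _ (fun y => (val (f y.1), y.2)) h _ _ _ _ (ch s t cs t01)).
apply: (@cvg_pair _ E R _ (nbhs (val (f s))) (nbhs t) _ _ _
  (fun y : 'rV_n * R => val (f y.1)) snd); last first.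
  by apply: cvg_within_filter; exact: cvg_snd.
have c1 : {within @unit_cube R n `*` `[0, 1]%classic,
   continuous ((fun s => val (f s)) \o (fst : 'rV[R]_n * R -> _))}.
  apply: (@within_comp _ _ _ _ (@unit_cube R n)).
  - apply: (@within_continuous_comp _ _ _ _ f (fun a : A => val a)) => //.
    exact: val_set_continuous.
  - by move=> y; exact: cvg_fst.
  - by move=> y [].
move/subspace_continuousP : c1 => /(_ (s, t)); apply.
by split=> //=; rewrite in_itv.
Qed.

(** Here [h] is a strong deformation retraction of [A] onto [B]: because it fixes
    the points of [B], it never moves the base point, and the homotopy it gives on
    spheroids is constant on the boundary of the cube. It is given on the ambient
    space, and has to be continuous at the points of [A] only, so that it may be
    written with divisions by quantities that vanish elsewhere. *)
Lemma isomorphic_retract (E : topologicalType) (A B : set E) (h : E * R -> E)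
    (a : E) (Aa : A a) (Ba : B a) q :
  B `<=` A ->
  (forall p t, A p -> 0 <= t <= 1 -> {for (p, t), continuous h}) ->
  (forall p t, A p -> 0 <= t <= 1 -> A (h (p, t))) ->
  (forall p, A p -> h (p, 0) = p) -> (forall p, A p -> B (h (p, 1))) ->
  (forall p t, B p -> 0 <= t <= 1 -> h (p, t) = p) ->
  isomorphic (homotopy_group R q.+1 (base_point Aa))
             (homotopy_group R q.+1 (base_point Ba)).
Proof.
move=> BA ch Ah h0 h1 hB.
have t01 : 0 <= (1 : R) <= 1 by rewrite ler01 lexx.
pose F (x : A) : B := into (base_point Ba) (h (val x, 1)).
pose G (x : B) : A := into (base_point Aa) (val x).
have cF : continuous F.
  apply: into_continuous => [x|x]; first by apply: h1; exact: set_typeP.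
  apply: (@continuous_comp A (E * R)%type E (fun x : A => (val x, 1)) h x); last first.
    by apply: ch => //; exact: set_typeP.
  exact: (cts_pair (@val_set_continuous E A) (@cts_cst A R 1)).
have cG : continuous G.
  apply: into_continuous => [x|x]; first by apply: BA; exact: set_typeP.
  exact: val_set_continuous.
have vG x : val (G x) = val x.
  by rewrite val_into//; apply: BA; exact: set_typeP.
have vF x : val (F x) = h (val x, 1).
  by rewrite val_into//; apply: h1; exact: set_typeP.
apply: (isomorphic_homotopy_group cF cG).
- by apply/val_inj; rewrite vF /= hB.
- by apply/val_inj; rewrite vG.
- move=> f Sf; apply: homotopic_sym.
  exists (fun y => into (base_point Aa) (h (val (f y.1), y.2))); split.
  + apply: within_into => [[s t] [/= _]|].
      by rewrite in_itv /= => ?; apply: Ah => //; exact: set_typeP.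
    by apply: (within_cylinder Sf.1) => s t cs ts; apply: ch => //; exact: set_typeP.
  + by move=> s cs /=; apply/val_inj; rewrite h0 ?val_into//; exact: set_typeP.
  + move=> s cs /=; apply/val_inj; rewrite vG vF val_into//.
    by apply: Ah => //; exact: set_typeP.
  + move=> s t bs ts /=; rewrite Sf.2//=; apply/val_inj.
    by rewrite hB ?val_into.
- move=> g Sg; rewrite (_ : _ \o g = g); first exact: homotopic_refl.
  apply/funext => s; apply/val_inj => /=; rewrite vF vG hB//; exact: set_typeP.
Qed.

End HomotopyEquivalence.

(** * Limits of matrix expressions *)

Section MatrixLimits.
Variables (R : realType) (T : Type) (F : set_system T).
Context {FF : Filter F}.

Lemma cvg_mx (m n : nat) (f : T -> 'M[R]_(m, n)) (L : 'M[R]_(m, n)) :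
  (forall i j, f t i j @[t --> F] --> L i j) -> f t @[t --> F] --> L.
Proof.
move=> cf U [P nP PU]; rewrite nbhs_simpl /=.
have : \forall z \near F, forall ij : 'I_m * 'I_n, P ij.1 ij.2 (f z ij.1 ij.2).
  by apply: filter_forall => -[i j]; exact: cf (nP i j).
by apply: filterS => z Pz; apply: PU => i j; exact: (Pz (i, j)).
Qed.

Lemma cvg_entry (m n : nat) (f : T -> 'M[R]_(m, n)) (L : 'M[R]_(m, n)) i j :
  f t @[t --> F] --> L -> f t i j @[t --> F] --> L i j.
Proof.
move=> cf; apply: (@cvg_comp _ _ _ f (fun M : 'M[R]_(m, n) => M i j) _ _ _ cf).
exact: coord_continuous.
Qed.

Lemma cvg_sumr (I : Type) (r : seq I) (P : pred I) (f : I -> T -> R) (l : I -> R) :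
  (forall i, P i -> f i t @[t --> F] --> l i) ->
  \sum_(i <- r | P i) f i t @[t --> F] --> \sum_(i <- r | P i) l i.
Proof. by move=> cf; apply: cvg_big => //; exact: add_continuous. Qed.

Lemma cvg_prodr (I : Type) (r : seq I) (P : pred I) (f : I -> T -> R) (l : I -> R) :
  (forall i, P i -> f i t @[t --> F] --> l i) ->
  \prod_(i <- r | P i) f i t @[t --> F] --> \prod_(i <- r | P i) l i.
Proof. by move=> cf; apply: cvg_big => //; exact: mul_continuous. Qed.

Lemma cvg_inner n (u v : T -> 'rV[R]_n) (a b : 'rV[R]_n) :
  u t @[t --> F] --> a -> v t @[t --> F] --> b ->
  inner (u t) (v t) @[t --> F] --> inner a b.
Proof.
by move=> cu cv; apply: cvg_sumr => i _; apply: cvgM; exact: cvg_entry.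
Qed.

Lemma cvg_scalemx m n (a : T -> R) (u : T -> 'M[R]_(m, n)) (c : R)
    (L : 'M[R]_(m, n)) :
  a t @[t --> F] --> c -> u t @[t --> F] --> L ->
  (a t *: u t) @[t --> F] --> c *: L.
Proof.
move=> ca cu; apply: cvg_mx => i j; under eq_cvg do rewrite mxE.
by rewrite mxE; apply: cvgM => //; exact: cvg_entry.
Qed.

Lemma cvg_addmx m n (u v : T -> 'M[R]_(m, n)) (K L : 'M[R]_(m, n)) :
  u t @[t --> F] --> K -> v t @[t --> F] --> L ->
  (u t + v t) @[t --> F] --> K + L.
Proof.
move=> ca cu; apply: cvg_mx => i j; under eq_cvg do rewrite mxE.
by rewrite mxE; apply: cvgD; exact: cvg_entry.
Qed.

Lemma cvg_mulmx m n p (A : T -> 'M[R]_(m, n)) (B : T -> 'M[R]_(n, p))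
    (K : 'M[R]_(m, n)) (L : 'M[R]_(n, p)) :
  A t @[t --> F] --> K -> B t @[t --> F] --> L ->
  (A t *m B t) @[t --> F] --> K *m L.
Proof.
move=> cA cB; apply: cvg_mx => i j; under eq_cvg do rewrite mxE.
by rewrite mxE; apply: cvg_sumr => k _; apply: cvgM; exact: cvg_entry.
Qed.

Lemma cvg_row m n (i : 'I_m) (A : T -> 'M[R]_(m, n)) (K : 'M[R]_(m, n)) :
  A t @[t --> F] --> K -> row i (A t) @[t --> F] --> row i K.
Proof.
move=> cA; apply: cvg_mx => k j; under eq_cvg do rewrite mxE.
by rewrite mxE; exact: cvg_entry.
Qed.

Lemma cvg_row' m n (i : 'I_m) (A : T -> 'M[R]_(m, n)) (K : 'M[R]_(m, n)) :
  A t @[t --> F] --> K -> row' i (A t) @[t --> F] --> row' i K.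
Proof.
move=> cA; apply: cvg_mx => k j; under eq_cvg do rewrite mxE.
by rewrite mxE; exact: cvg_entry.
Qed.

Lemma cvg_det n (A : T -> 'M[R]_n) (K : 'M[R]_n) :
  A t @[t --> F] --> K -> \det (A t) @[t --> F] --> \det K.
Proof.
move=> cA; apply: cvg_sumr => s _; apply: cvgM; first exact: cvg_cst.
by apply: cvg_prodr => i _; exact: cvg_entry.
Qed.

Lemma cvg_cofactor n (A : T -> 'M[R]_n) (K : 'M[R]_n) i j :
  A t @[t --> F] --> K -> cofactor (A t) i j @[t --> F] --> cofactor K i j.
Proof.
move=> cA; apply: cvgM; first exact: cvg_cst.
apply: cvg_det; apply: cvg_row'; apply: cvg_mx => k l.
under eq_cvg do rewrite mxE.
by rewrite mxE; exact: cvg_entry.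
Qed.

(** Near an invertible matrix the determinant stays nonzero and the inverse is
    the adjugate over the determinant. *)
Lemma cvg_invmx n (A : T -> 'M[R]_n) (K : 'M[R]_n) : K \in unitmx ->
  A t @[t --> F] --> K -> invmx (A t) @[t --> F] --> invmx K.
Proof.
move=> uK cA; have cd := cvg_det cA; rewrite unitmxE unitfE in uK.
rewrite /invmx unitmxE unitfE uK.
suff c : ((\det (A t))^-1 *: \adj (A t)) @[t --> F] --> (\det K)^-1 *: \adj K.
  apply: cvg_trans c; apply: near_eq_cvg.
  have /cd : nbhs (\det K) [set x : R | x != 0].
    by apply: open_nbhs_nbhs; split=> //; exact: open_neq.
  by rewrite /= nbhs_simpl /=; apply: filterS => t dt; rewrite unitmxE unitfE dt.
apply: cvg_scalemx; first exact: cvgV.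
apply: cvg_mx => i j; under eq_cvg do rewrite mxE.
by rewrite mxE; exact: cvg_cofactor.
Qed.

End MatrixLimits.

Section Normalization.
Variables (R : realType) (n : nat).
Implicit Types u v : 'rV[R]_n.

Definition normalize u := (enorm u)^-1 *: u.

Lemma enorm_gt0 u : u != 0 -> 0 < enorm u.
Proof.
move=> u0; rewrite sqrtr_gt0 lt_neqAle inner_ge0 andbT eq_sym.
apply: contra_neq u0; rewrite /inner => /eqP.
rewrite psumr_eq0 => [/allP h|i _]; last by rewrite -expr2 sqr_ge0.
apply/rowP => i; rewrite mxE; have /implyP/(_ isT) := h i (mem_index_enum _).
by rewrite mulf_eq0 orbb => /eqP.
Qed.

Lemma enorm_normalize u : u != 0 -> enorm (normalize u) = 1.
Proof.
move=> /enorm_gt0 u0; rewrite enormZ ger0_norm ?invr_ge0 ?ltW// mulVf//.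
by rewrite gt_eqF.
Qed.

Lemma normalize_id u : enorm u = 1 -> normalize u = u.
Proof. by rewrite /normalize => ->; rewrite invr1 scale1r. Qed.

Lemma normalizeZ (a : R) u : 0 < a -> normalize (a *: u) = normalize u.
Proof.
move=> a0; rewrite /normalize enormZ gtr0_norm// scalerA invfM mulrAC mulVf ?mul1r//.
by rewrite gt_eqF.
Qed.

Lemma cvg_normalize (T : Type) (F : set_system T) (FF : Filter F)
    (u : T -> 'rV[R]_n) v : v != 0 ->
  u t @[t --> F] --> v -> normalize (u t) @[t --> F] --> normalize v.
Proof.
move=> v0 cu; apply: cvg_scalemx => //; apply: cvgV; first by rewrite gt_eqF// enorm_gt0.
apply: (cvg_comp _ _ (cvg_inner cu cu)); exact: sqrt_continuous.
Qed.

End Normalization.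

(** * Inner products and independent rows *)

Section InnerProduct.
Variables (R : realType) (N : nat).
Implicit Types u v w : 'rV[R]_N.

Lemma innerC u v : inner u v = inner v u.
Proof. by apply: eq_bigr => i _; rewrite mulrC. Qed.

Lemma innerBl u v w : inner (u - v) w = inner u w - inner v w.
Proof.
rewrite /inner -sumrB; apply: eq_bigr => i _; rewrite !mxE; ring.
Qed.

Lemma innerZl (a : R) u v : inner (a *: u) v = a * inner u v.
Proof. by rewrite /inner big_distrr /=; apply: eq_bigr => i _; rewrite mxE mulrA. Qed.

Lemma inner_mulmxl n (d : 'rV[R]_n) (p : 'M[R]_(n, N)) v :
  inner (d *m p) v = \sum_j d 0 j * inner (row j p) v.
Proof.
rewrite /inner; under [RHS]eq_bigr do rewrite big_distrr /=.
rewrite exchange_big; apply: eq_bigr => i _; rewrite mxE big_distrl /=.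
by apply: eq_bigr => j _; rewrite !mxE mulrA.
Qed.

Lemma sphere_neq0 u : enorm u = 1 -> u != 0.
Proof.
move=> u1; apply/eqP => u0; move: u1; rewrite u0 /enorm /inner big1 => [|i _].
  by rewrite sqrtr0 => /eqP; rewrite eq_sym oner_eq0.
by rewrite mxE mul0r.
Qed.

End InnerProduct.

Section FreeRows.
Variables (R : realType).

Lemma free_family_inj (I : finType) (N : nat) (v : I -> 'rV[R]_N) (A : {set I})
    (c : I -> R) :
  free [seq v i | i in A] -> \sum_(i in A) c i *: v i = 0 ->
  forall i, i \in A -> c i = 0.
Proof.
move=> fA cv i iA; have fX : free (image_tuple v (mem A)) by [].
have /freeP h := fX.
have := h (fun j => c (enum_val j)) _ (enum_rank_in iA i).
rewrite enum_rankK_in//; apply.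
rewrite big_enum_val in cv; rewrite -[RHS]cv; apply: eq_bigr => j _.
by rewrite nth_image.
Qed.

Lemma row_free_subfamily n N (p : 'M[R]_(n, N)) (I : {set 'I_n}) :
  row_free p -> free [seq row i p | i in I].
Proof.
move=> fp; apply: free_familyP => c c0 i iI.
have : (\row_j if j \in I then c j else 0) *m p = 0 *m p.
  rewrite mul0mx -[RHS]c0 mulmx_sum_row [RHS]big_mkcond.
  by apply: eq_bigr => j _; rewrite mxE; case: ifP => //; rewrite scale0r.
by move/(row_free_inj fp)/rowP/(_ i); rewrite !mxE iI.
Qed.

Lemma row_free_free n N (p : 'M[R]_(n, N)) :
  free [seq row i p | i in [set: 'I_n]%SET] -> row_free p.
Proof.
move=> fp; apply: inj_row_free => v v0; apply/rowP => i; rewrite mxE.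
apply: (@free_family_inj _ _ (fun j => row j p) _ (v 0) fp); rewrite ?inE//.
rewrite -[RHS]v0 mulmx_sum_row.
by apply: eq_bigl => j; rewrite inE.
Qed.

End FreeRows.

(** * Gram-Schmidt orthonormalization, one row at a time *)

Section GramSchmidt.
Variables (R : realType) (n N : nat).
Implicit Types (p : 'M[R]_(n, N)) (i : 'I_n).

(** Independent unit vectors of which the first [k] are orthonormal. These sets
    decrease from the configuration space, for [k] = 0, to the Stiefel manifold,
    for [k] = [n]; each is a strong deformation retract of the one before. *)
Definition partial_frames (k : nat) : set 'M[R]_(n, N) :=
  [set p | [/\ forall i, enorm (row i p) = 1, row_free p &
    forall i j : 'I_n, (i < k)%N -> (j < k)%N ->
      inner (row i p) (row j p) = (i == j)%:R]].

Definition gs_coef i p : 'rV[R]_n :=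
  \row_j if (j < i)%N then inner (row i p) (row j p) else 0.

Definition gs_vec i (y : 'M[R]_(n, N) * R) : 'rV[R]_N :=
  row i y.1 - y.2 *: (gs_coef i y.1 *m y.1).

(** The deformation of stage [i]: at time [t], [t] times the projection onto the
    span of the rows before [i] has been subtracted from row [i], which is then
    normalized. *)
Definition gs_step i (y : 'M[R]_(n, N) * R) : 'M[R]_(n, N) :=
  \matrix_(l < n) if l == i then normalize (gs_vec i y) else row l y.1.

Lemma gs_vecE i p t :
  gs_vec i (p, t) = (delta_mx 0 i - t *: gs_coef i p) *m p.
Proof. by rewrite /gs_vec mulmxBl -rowE scalemxAl. Qed.

(** In the basis of the rows of [p], the coordinate of index [i] of this vector
    is 1. *)
Lemma gs_vec_neq0 i p t : row_free p -> gs_vec i (p, t) != 0.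
Proof.
move=> fp; apply/eqP; rewrite gs_vecE -(mul0mx _ p) => /(row_free_inj fp)/rowP/(_ i).
by rewrite !mxE !eqxx ltnn mulr0 subr0 => /eqP; rewrite oner_eq0.
Qed.

(** The new rows are obtained from those of [p] by a triangular change of basis
    whose only nontrivial row is row [i], with a nonzero diagonal entry. *)
Lemma gs_step_row_free i p t : row_free p -> row_free (gs_step i (p, t)).
Proof.
move=> fp; have a0 : (enorm (gs_vec i (p, t)))^-1 != 0.
  by rewrite invr_eq0 gt_eqF// enorm_gt0// gs_vec_neq0.
pose a := (enorm (gs_vec i (p, t)))^-1.
apply: inj_row_free => v v0.
(* the coordinates of [v *m gs_step i (p, t)] in the rows of [p] *)
have : ((a * v 0 i) *: (delta_mx 0 i - t *: gs_coef i p) +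
        (v - v 0 i *: delta_mx 0 i)) *m p = 0 *m p.
  rewrite mul0mx -[RHS]v0 mulmxDl mulmxBl -!scalemxAl -rowE -gs_vecE.
  rewrite !mulmx_sum_row (bigD1 i)//= [in RHS](bigD1 i)//= rowK eqxx /normalize.
  rewrite addrAC subrr add0r scalerA [v 0 i * _]mulrC; congr (_ + _).
  by apply: eq_bigr => j ji; rewrite rowK (negbTE ji).
move/(row_free_inj fp) => e; have vi : v 0 i = 0.
  move/rowP/(_ i): e; rewrite !mxE !eqxx ltnn mulr0 subr0 !mulr1 subrr addr0.
  by move/eqP; rewrite mulf_eq0 (negbTE a0) => /eqP.
by move: e; rewrite vi mulr0 !scale0r add0r subr0.
Qed.

Lemma gs_step_unit i p t : row_free p -> (forall l, enorm (row l p) = 1) ->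
  forall l, enorm (row l (gs_step i (p, t))) = 1.
Proof.
move=> fp up l; rewrite rowK; case: eqP => _ //.
by rewrite enorm_normalize// gs_vec_neq0.
Qed.

Lemma gs_step_orthonormal i p t (k : nat) : (k <= i)%N ->
  (forall l j : 'I_n, (l < k)%N -> (j < k)%N -> inner (row l p) (row j p) = (l == j)%:R) ->
  forall l j : 'I_n, (l < k)%N -> (j < k)%N ->
    inner (row l (gs_step i (p, t))) (row j (gs_step i (p, t))) = (l == j)%:R.
Proof.
move=> ki op l j lk jk; rewrite !rowK !ifF ?op//.
  by apply/negbTE; rewrite -val_eqE ltn_eqF//; exact: leq_trans ki.
by apply/negbTE; rewrite -val_eqE ltn_eqF//; exact: leq_trans ki.
Qed.

Lemma gs_vec_orthogonal i p (k : 'I_n) : (k < i)%N ->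
  (forall l j : 'I_n, (l < i)%N -> (j < i)%N ->
    inner (row l p) (row j p) = (l == j)%:R) ->
  inner (gs_vec i (p, 1)) (row k p) = 0.
Proof.
move=> ki op; rewrite /gs_vec /= innerBl scale1r inner_mulmxl (bigD1 k)//=.
rewrite mxE ki (op k k)// eqxx mulr1 big1 ?addr0 ?subrr// => j jk.
by rewrite mxE; case: ifPn => ji; rewrite ?mul0r// (op j k)// (negbTE jk) mulr0.
Qed.

Lemma gs_step_frames i p :
  partial_frames i p -> partial_frames i.+1 (gs_step i (p, 1)).
Proof.
move=> [up fp op]; have up' := gs_step_unit i 1 fp up.
have fp' := gs_step_row_free i 1 fp.
split=> // l j; rewrite !ltnS => li ji.
have unit_inner (u : 'rV[R]_N) : enorm u = 1 -> inner u u = 1.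
  move=> u1; have := sqr_sqrtr (inner_ge0 u).
  by rewrite -/(enorm u) u1 expr1n.
have [->|lj] := eqVneq l j; first by rewrite unit_inner.
have off k : k != i -> (k <= i)%N -> inner (row i (gs_step i (p, 1)))
    (row k (gs_step i (p, 1))) = 0.
  move=> ki ki'; rewrite !rowK eqxx (negbTE ki) innerZl gs_vec_orthogonal ?mulr0//.
  by rewrite ltn_neqAle ki' andbT.
have [lE|li'] := eqVneq l i.
  by rewrite lE in lj *; rewrite off ?(negbTE lj)// eq_sym.
have [jE|ji'] := eqVneq j i.
  by rewrite jE in lj *; rewrite innerC off ?(negbTE lj).
rewrite (gs_step_orthonormal _ (leqnn i))// ?(negbTE lj)//.
  by rewrite ltn_neqAle li andbT.
by rewrite ltn_neqAle ji'.
Qed.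

(** On frames that are already orthonormal up to row [i] the projection
    vanishes, which makes the retraction strong. *)
Lemma gs_step_id i p t : (forall l, enorm (row l p) = 1) ->
  (t = 0 \/ partial_frames i.+1 p) -> gs_step i (p, t) = p.
Proof.
move=> up h; apply/row_matrixP => l; rewrite rowK; case: eqP => // ->.
rewrite /gs_vec /= (_ : t *: _ = 0) ?subr0 ?normalize_id//.
case: h => [->|[_ _ op]]; first by rewrite scale0r.
rewrite (_ : gs_coef i p = 0) ?mul0mx ?scaler0//.
apply/rowP => j; rewrite !mxE; case: ifP => // ji.
by rewrite op// ?(ltnW ji)// ?ltnS ?(ltnW ji)// -val_eqE gtn_eqF.
Qed.

Lemma gs_step_continuous i p t :
  row_free p -> {for (p, t), continuous (gs_step i)}.
Proof.
move=> fp; have c1 : (fun y : 'M[R]_(n, N) * R => y.1) @ (p, t) --> p by exact: cvg_fst.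
have c2 : (fun y : 'M[R]_(n, N) * R => y.2) @ (p, t) --> t by exact: cvg_snd.
apply: cvg_mx => l j; under eq_cvg do rewrite mxE; rewrite mxE.
case: (l == i); last by apply: cvg_entry; exact: cvg_row.
apply: cvg_entry; apply: cvg_normalize; first exact: gs_vec_neq0.
rewrite /gs_vec -[- _]scaleN1r; under eq_cvg do rewrite -[- _]scaleN1r.
apply: cvg_addmx; first exact: cvg_row.
apply: cvg_scalemx; first exact: cvg_cst.
apply: cvg_scalemx => //; apply: cvg_mulmx => //.
apply: cvg_mx => k l'; under eq_cvg do rewrite mxE; rewrite mxE.
by case: ifP => _; [apply: cvg_inner; exact: cvg_row|exact: cvg_cst].
Qed.

End GramSchmidt.

Section FramesStiefel.
Variables (R : realType).

(** Transport along an equality of subsets that are not convertible. *)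
Lemma isomorphic_base_point_eq (E : topologicalType) (A B : set E) (a : E)
    (Aa : A a) (Ba : B a) q : A = B ->
  isomorphic (homotopy_group R q.+1 (base_point Aa))
             (homotopy_group R q.+1 (base_point Ba)).
Proof.
move=> AB; case: _ / AB in Ba *; rewrite (Prop_irrelevance Aa Ba).
exact: isomorphic_refl.
Qed.

Lemma isomorphic_partial_frames n N (b : 'M[R]_(n, N)) (k : nat)
    (b0 : partial_frames 0 b) (bk : partial_frames k b) q :
  (k <= n)%N ->
  isomorphic (homotopy_group R q.+1 (base_point b0))
             (homotopy_group R q.+1 (base_point bk)).
Proof.
elim: k bk => [|k IHk] bk kn; first exact: isomorphic_base_point_eq.
have bk' : partial_frames k b.
  by case: bk => ub fb ob; split=> // i j ik jk; apply: ob; exact: ltnW.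
apply: isomorphic_trans (IHk bk' (ltnW kn)) _.
pose i := Ordinal kn.
apply: (@isomorphic_retract _ _ _ _ (@gs_step R n N i)).
- by move=> p [up fp op]; split=> // l j lk jk; apply: op; exact: ltnW.
- by move=> p t [up fp op] _; exact: gs_step_continuous.
- move=> p t [up fp op] _; split; [exact: gs_step_unit|exact: gs_step_row_free|].
  exact: gs_step_orthonormal.
- by move=> p [up _ _]; apply: gs_step_id => //; left.
- by move=> p Wp; exact: (gs_step_frames (i := i)).
- by move=> p t Wp _; apply: gs_step_id; [case: Wp|right].
Qed.

Lemma confW_frames n m : confW R n n m = @partial_frames R n m.+1 0.
Proof.
apply/seteqP; split=> p [up].
  move=> fp; split=> //; apply: row_free_free; apply: fp.
  by rewrite cardsT card_ord.
by move=> fp _; split=> // I _; exact: row_free_subfamily.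
Qed.

Lemma stiefel_frames n m : stiefel R m n = @partial_frames R n m n.
Proof.
apply/seteqP; split=> p; last by move=> [_ _ op] i j; exact: op.
move=> op; split=> [i||i j _ _]; last exact: op.
  by rewrite /enorm op eqxx sqrtr1.
apply: inj_row_free => v v0; apply/rowP => k; rewrite mxE.
have : inner (v *m p) (row k p) = 0.
  by rewrite v0 /inner big1// => j _; rewrite mxE mul0r.
rewrite inner_mulmxl (bigD1 k)//= op eqxx mulr1 big1 ?addr0// => j jk.
by rewrite op (negbTE jk) mulr0.
Qed.

Lemma isomorphic_confW_stiefel n m (n_le : (n <= m.+1)%N) q :
  isomorphic (homotopy_group R q.+1 (b_confW R n n_le))
             (homotopy_group R q.+1 (b_stiefel R n_le)).
Proof.
have b0 : @partial_frames R n m.+1 0 (frame R n m.+1).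
  by rewrite -confW_frames; exact: frame_confW.
have bn : @partial_frames R n m.+1 n (frame R n m.+1).
  by rewrite -stiefel_frames; exact: frame_stiefel.
apply: isomorphic_trans (isomorphic_base_point_eq _ b0 q (confW_frames n m)) _.
apply: isomorphic_trans (isomorphic_partial_frames b0 bn q (leqnn n)) _.
by apply: isomorphic_base_point_eq; rewrite stiefel_frames.
Qed.

End FramesStiefel.

(** * Configurations with one more point *)

Section AppendRow.
Variables (R : realType).
Implicit Types (n N k : nat).

Definition snoc n N (p : 'M[R]_(n, N)) (x : 'rV[R]_N) : 'M[R]_(n.+1, N) :=
  \matrix_(i < n.+1) if unlift ord_max i is Some j then row j p else x.

Lemma row_snoc_lift n N (p : 'M[R]_(n, N)) (x : 'rV[R]_N) i :
  row (lift ord_max i) (snoc p x) = row i p.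
Proof. by rewrite rowK liftK. Qed.

Lemma row_snoc_last n N (p : 'M[R]_(n, N)) x : row ord_max (snoc p x) = x.
Proof. by rewrite rowK unlift_none. Qed.

Lemma row'_snoc n N (p : 'M[R]_(n, N)) x : row' ord_max (snoc p x) = p.
Proof.
apply/matrixP => i j; rewrite mxE.
by have /rowP/(_ j) := row_snoc_lift p x i; rewrite mxE => ->; rewrite mxE.
Qed.

Lemma snoc_row' n N (M : 'M[R]_(n.+1, N)) :
  snoc (row' ord_max M : 'M[R]_(n, N)) (row ord_max M) = M.
Proof.
apply/row_matrixP => i; rewrite rowK; case: unliftP => [j|] -> //.
by apply/rowP => l; rewrite !mxE.
Qed.

Lemma mulmx_snoc n N (v : 'rV[R]_n.+1) (p : 'M[R]_(n, N)) x :
  v *m snoc p x = (\row_j v 0 (lift ord_max j)) *m p + v 0 ord_max *: x.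
Proof.
rewrite !mulmx_sum_row big_ord_recr /= row_snoc_last; congr (_ + _).
apply: eq_bigr => i _; rewrite mxE.
have -> : widen_ord (leqnSn n) i = lift ord_max i.
  by apply/val_inj; rewrite /= /bump leqNgt ltn_ord.
by rewrite row_snoc_lift.
Qed.

Lemma snoc_mulmx n N K (p : 'M[R]_(n, N)) x (T : 'M[R]_(N, K)) :
  snoc p x *m T = snoc (p *m T) (x *m T).
Proof.
apply/row_matrixP => i; rewrite row_mul !rowK.
by case: unliftP => [j _|_] //; rewrite row_mul.
Qed.

Lemma cvg_snoc (T : Type) (F : set_system T) (FF : Filter F) n N
    (p : T -> 'M[R]_(n, N)) (x : T -> 'rV[R]_N) (q : 'M[R]_(n, N)) (y : 'rV[R]_N) :
  p t @[t --> F] --> q -> x t @[t --> F] --> y ->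
  snoc (p t) (x t) @[t --> F] --> snoc q y.
Proof.
move=> cp cx; apply: cvg_mx => i j; under eq_cvg do rewrite mxE; rewrite mxE.
by case: unliftP => [l _|_]; apply: cvg_entry => //; exact: cvg_row.
Qed.

Lemma free_snoc_lift n N (p : 'M[R]_(n, N)) x (I : {set 'I_n}) :
  free [seq row i (snoc p x) | i in lift ord_max @: I] =
  free [seq row i p | i in I].
Proof.
have /perm_free -> : perm_eq [seq row i (snoc p x) | i in lift ord_max @: I]
    [seq row i (snoc p x) | i <- [seq lift ord_max j | j in I]].
  apply: perm_map; apply: uniq_perm; first exact: enum_uniq.
    by rewrite map_inj_uniq ?enum_uniq//; exact: lift_inj.
  move=> i; rewrite mem_enum; apply/imsetP/fintype.imageP => -[j jI ->]; by exists j.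
rewrite -map_comp; congr (free _); apply: eq_map => j /=.
exact: row_snoc_lift.
Qed.

Lemma free_snoc_last n N (p : 'M[R]_(n, N)) x (I : {set 'I_n}) :
  free [seq row i (snoc p x) | i in ord_max |: lift ord_max @: I] =
  free (x :: [seq row i p | i in I]).
Proof.
have /perm_free -> : perm_eq
    [seq row i (snoc p x) | i in ord_max |: lift ord_max @: I]
    [seq row i (snoc p x) | i <- ord_max :: [seq lift ord_max j | j in I]].
  apply: perm_map; apply: uniq_perm; first exact: enum_uniq.
    rewrite /= map_inj_uniq ?enum_uniq ?andbT; last exact: lift_inj.
    by apply/fintype.imageP => -[j _ /eqP]; rewrite (negbTE (neq_lift _ _)).
  move=> i; rewrite mem_enum !inE; case: eqP => //= _.
  by apply/imsetP/fintype.imageP => -[j jI ->]; exists j.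
rewrite /= row_snoc_last -map_comp; congr (free (_ :: _)); apply: eq_map => j /=.
exact: row_snoc_lift.
Qed.

(** A family of [k.+1] points out of [n.+1] either avoids the last point, and is
    then a family of the first [n], or consists of the last point and [k] of the
    others. So the fibre over [p] of the map that drops the last point is the
    complement of [confQ k p]. *)
Lemma confW_snoc k n m (p : 'M[R]_(n, m.+1)) x :
  confW R k.+1 n.+1 m (snoc p x) <->
  confW R k.+1 n m p /\ (sphere R m `\` confQ k p) x.
Proof.
have maxn (I : {set 'I_n}) : ord_max \notin lift ord_max @: I.
  by apply/imsetP => -[j _ /eqP]; rewrite (negbTE (neq_lift _ _)).
split=> [[up fp]|[[up fp] [ux fx]]].
  split; split.
  - by move=> i; rewrite -(row_snoc_lift p x).
  - move=> I cI; rewrite -(free_snoc_lift p x); apply: fp.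
    by rewrite card_imset//; exact: lift_inj.
  - by rewrite -[x](row_snoc_last p).
  - move=> [I /= cI [_ /negP]]; apply; rewrite -free_snoc_last; apply: fp.
    by rewrite cardsU1 maxn card_imset ?cI//; exact: lift_inj.
split=> [i|J cJ].
  case: (unliftP ord_max i) => [j|] ->; first by rewrite row_snoc_lift.
  by rewrite row_snoc_last.
pose I := lift ord_max @^-1: J.
have JE i : (lift ord_max i \in lift ord_max @: I) = (lift ord_max i \in J).
  by rewrite mem_imset ?inE//; exact: lift_inj.
case: (boolP (ord_max \in J)) => maxJ.
  have JI : J = ord_max |: lift ord_max @: I.
    apply/setP => i; rewrite 2!inE; case: (unliftP ord_max i) => [j|] ->.
      by rewrite eq_sym (negbTE (neq_lift _ _)) JE.
    by rewrite eqxx maxJ.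
  rewrite JI free_snoc_last; apply/negP => /negP nf; apply: fx; exists I => //=.
  move: cJ; rewrite JI cardsU1 maxn card_imset//; last exact: lift_inj.
  by case.
have JI : J = lift ord_max @: I.
  apply/setP => i; case: (unliftP ord_max i) => [j|] ->; first by rewrite JE.
  by rewrite (negbTE maxJ) (negbTE (maxn _)).
rewrite JI free_snoc_lift; apply: fp.
by rewrite -cJ JI card_imset//; exact: lift_inj.
Qed.

End AppendRow.

(** * Transport of the fibres by linear maps *)

Section LinearInvariance.
Variables (R : realType).

Lemma free_mulmx N (T : 'M[R]_N) (s : seq 'rV[R]_N) : T \in unitmx ->
  free s -> free [seq v *m T | v <- s].
Proof.
move=> uT fs; pose f : 'Hom('rV[R]_N, 'rV[R]_N) := linfun (mulmxr T).
have kf : (lker f == 0)%VS.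
  by apply/lker0P => u v; rewrite !lfunE /= => /(can_inj (mulmxK uT)).
have bs : basis_of (span s) s by rewrite basisEfree fs subvv /= dim_span.
have := limg_basis_of (f := f) _ bs; rewrite (eqP kf) capv0 => /(_ erefl).
move=> /basis_free; congr (is_true (free _)).
by apply: eq_map => v; rewrite lfunE.
Qed.

Lemma free_consZ (N : nat) (a : R) (x : 'rV[R]_N) (s : seq 'rV[R]_N) :
  a != 0 -> free (a *: x :: s) = free (x :: s).
Proof. by move=> a0; rewrite !free_cons rpredZeq (negbTE a0). Qed.

Lemma mulmx_neq0 N (T : 'M[R]_N) (x : 'rV[R]_N) :
  T \in unitmx -> x != 0 -> x *m T != 0.
Proof.
move=> uT; apply: contra_neq => xT0; apply: (can_inj (mulmxK uT)).
by rewrite xT0 mul0mx.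
Qed.

Lemma confQ_mulmx k n m (p b : 'M[R]_(n, m.+1)) (T : 'M[R]_m.+1) x :
  T \in unitmx -> p *m T = b -> sphere R m x ->
  confQ k b (normalize (x *m T)) -> confQ k p x.
Proof.
move=> uT pT ux [I cI [_ nf]]; exists I => //; split=> //.
apply: contra nf => fx; rewrite free_consZ; last first.
  by rewrite invr_eq0 gt_eqF// enorm_gt0// mulmx_neq0// sphere_neq0.
have /= := free_mulmx uT fx; congr (is_true (free (_ :: _))).
by rewrite /image_mem -map_comp; apply: eq_map => i /=; rewrite -row_mul pT.
Qed.

Lemma normalize_mulmxK N (T T' : 'M[R]_N) (x : 'rV[R]_N) : T *m T' = 1%:M ->
  enorm x = 1 -> normalize (normalize (x *m T) *m T') = x.
Proof.
move=> TT ux; have [uT uT'] := mulmx1_unit TT.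
rewrite -scalemxAl normalizeZ; last first.
  by rewrite invr_gt0 enorm_gt0// mulmx_neq0// sphere_neq0.
by rewrite -mulmxA TT mulmx1 normalize_id.
Qed.

End LinearInvariance.

(** * The normal vector to n independent vectors in dimension n + 1 *)

Section NormalVector.
Variables (R : realType) (n : nat).
Implicit Types (p : 'M[R]_(n, n.+1)).

(** The generalized cross product of the rows of [p]: the cofactors along the
    last row, which the last row itself does not affect. *)
Definition normal p : 'rV[R]_n.+1 := \row_j cofactor (snoc p 0) ord_max j.

Lemma det_snoc p y : \det (snoc p y) = inner y (normal p).
Proof.
rewrite (expand_det_row _ ord_max); apply: eq_bigr => j _.
have /rowP/(_ j) := row_snoc_last p y; rewrite mxE => ->; rewrite mxE.
rewrite /cofactor; congr (_ * (_ * \det _)).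
by apply/matrixP => k l; rewrite !mxE liftK.
Qed.

Definition normal_frame p : 'M[R]_n.+1 := snoc p (normal p).

(** The determinant of this matrix is the squared norm of the normal vector. The
    normal vector is nonzero because its inner product with any [y] outside the
    span of the rows of [p] is a nonzero determinant. *)
Lemma normal_frame_unit p : row_free p -> normal_frame p \in unitmx.
Proof.
move=> fp; suff N0 : normal p != 0.
  rewrite unitmxE unitfE det_snoc; apply: contra_neq N0 => NN.
  by apply/eqP; apply/negPn/negP => /enorm_gt0; rewrite /enorm NN sqrtr0 ltxx.
have [y yp] : exists y : 'rV[R]_n.+1, ~~ (y <= p)%MS.
  have : ~~ (1%:M <= p)%MS.
    by apply/negP => /mxrankS; rewrite mxrank1 (eqP fp) ltnn.
  by move=> /row_subPn[i pi]; exists (row i 1%:M).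
have : snoc p y \in unitmx.
  rewrite -row_free_unit; apply: inj_row_free => v; rewrite mulmx_snoc => v0.
  have vl : v 0 ord_max = 0.
    apply/eqP; apply: contraNT yp => vl.
    rewrite -(eqmx_scale _ vl); apply/submxP; exists (- \row_j v 0 (lift ord_max j)).
    by apply/eqP; rewrite mulNmx -addr_eq0 addrC v0.
  have /(row_free_inj fp)/rowP vr : (\row_j v 0 (lift ord_max j)) *m p = 0 *m p.
    by rewrite mul0mx -[RHS]v0 vl scale0r addr0.
  apply/rowP => i; rewrite mxE; case: (unliftP ord_max i) => [j|] -> //.
  by have := vr j; rewrite !mxE.
rewrite unitmxE unitfE det_snoc; apply: contra_neq => ->.
by rewrite innerC /inner big1// => j _; rewrite mxE mul0r.
Qed.

Lemma cvg_normal_frame (T : Type) (F : set_system T) (FF : Filter F)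
    (p : T -> 'M[R]_(n, n.+1)) (q : 'M[R]_(n, n.+1)) :
  p t @[t --> F] --> q -> normal_frame (p t) @[t --> F] --> normal_frame q.
Proof.
move=> cp; apply: cvg_snoc => //; apply: cvg_mx => i j.
under eq_cvg do rewrite mxE; rewrite mxE; apply: cvg_cofactor.
by apply: cvg_snoc => //; exact: cvg_cst.
Qed.

(** The linear map sending the rows of [p] and their normal vector to those
    of [b]. *)
Definition transport p b := invmx (normal_frame p) *m normal_frame b.

Lemma transportK p b : row_free p -> row_free b ->
  transport p b *m transport b p = 1%:M.
Proof.
move=> fp fb; rewrite /transport mulmxA -(mulmxA (invmx _)).
by rewrite mulmxV ?normal_frame_unit// mulmx1 mulVmx// normal_frame_unit.
Qed.

Lemma transport_unit p b : row_free p -> row_free b -> transport p b \in unitmx.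
Proof. by move=> fp fb; have [] := mulmx1_unit (transportK fp fb). Qed.

Lemma mulmx_transport p b : row_free p -> p *m transport p b = b.
Proof.
move=> fp; have : normal_frame p *m transport p b = normal_frame b.
  by rewrite /transport mulmxA mulmxV ?mul1mx// normal_frame_unit.
rewrite {1}/normal_frame snoc_mulmx => /(congr1 (row' ord_max)).
by rewrite !row'_snoc.
Qed.

End NormalVector.

(** * Trivialization of the fibration that drops the last point *)

Section LastPoint.
Variables (R : realType) (m : nat).
Local Notation b := (frame R m.+1 m.+2).
Local Notation W := (confW R m.+1 m.+1 m.+1).
Local Notation Q := (sphere R m.+1 `\` confQ m b).

Lemma row_free_frame : row_free b.
Proof.
by apply: row_free_free; rewrite free_frame.
Qed.

Lemma confW_row_free n k (p : 'M[R]_(n, k.+1)) : confW R n n k p -> row_free p.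
Proof. by rewrite confW_frames => -[]. Qed.

(** Every fibre is identified with the fibre over the standard frame [b] by the
    linear map [transport p b], followed by normalization. As this map depends
    continuously on [p], the fibration is globally a product. *)
Definition split_point (M : confW R m.+1 m.+2 m.+1) : (W * Q)%type :=
  let p := row' ord_max (val M) : 'M[R]_(m.+1, m.+2) in
  (into (b_confW R m.+1 (leqnSn m.+1)) p,
   into (e_confQ R m m.+1) (normalize (row ord_max (val M) *m transport p b))).

Definition join_point (y : (W * Q)%type) : confW R m.+1 m.+2 m.+1 :=
  into (b_confW R m.+1 (leqnn m.+2))
    (snoc (val y.1) (normalize (val y.2 *m transport b (val y.1)))).

Lemma split_point_fst (M : confW R m.+1 m.+2 m.+1) :
  W (row' ord_max (val M) : 'M[R]_(m.+1, m.+2)).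
Proof.
have : confW R m.+1 m.+2 m.+1 (val M) := set_typeP M.
by rewrite -{1}[val M]snoc_row' => /confW_snoc[].
Qed.

Lemma confQ_transport (p q : 'M[R]_(m.+1, m.+2)) x : W p -> W q ->
  (sphere R m.+1 `\` confQ m p) x ->
  (sphere R m.+1 `\` confQ m q) (normalize (x *m transport p q)).
Proof.
move=> /confW_row_free fp /confW_row_free fq [ux nQ].
have uT := transport_unit fp fq; split.
  by apply: enorm_normalize; apply: mulmx_neq0 => //; exact: sphere_neq0.
by apply: contra_not nQ; apply: confQ_mulmx => //; exact: mulmx_transport.
Qed.

Lemma split_point_snd (M : confW R m.+1 m.+2 m.+1) :
  Q (normalize (row ord_max (val M) *m
       transport (row' ord_max (val M) : 'M[R]_(m.+1, m.+2)) b)).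
Proof.
have : confW R m.+1 m.+2 m.+1 (val M) := set_typeP M.
rewrite -{1}[val M]snoc_row' => /confW_snoc[Wp Qx].
by apply: confQ_transport => //; exact: frame_confW.
Qed.

Lemma join_pointP (y : (W * Q)%type) : confW R m.+1 m.+2 m.+1
  (snoc (val y.1) (normalize (val y.2 *m transport b (val y.1)))).
Proof.
apply/confW_snoc; have Wp := set_typeP y.1; split=> //.
by apply: confQ_transport => //; [exact: frame_confW|exact: set_typeP].
Qed.

Lemma split_pointK : cancel split_point join_point.
Proof.
move=> M; apply/val_inj; rewrite val_into; last exact: join_pointP.
rewrite /split_point /= !val_into; [|exact: split_point_snd|exact: split_point_fst].
have fp := confW_row_free (split_point_fst M).
rewrite normalize_mulmxK ?snoc_row'//; first exact: transportK row_free_frame.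
have : confW R m.+1 m.+2 m.+1 (val M) := set_typeP M.
by case=> /(_ ord_max).
Qed.

Lemma join_pointK : cancel join_point split_point.
Proof.
move=> y; have Wy := join_pointP y.
have fp := confW_row_free (set_typeP y.1).
case: y => p x in Wy fp *; congr pair; apply/val_inj.
  by rewrite val_into; [|exact: split_point_fst]; rewrite val_into// row'_snoc.
rewrite val_into; last exact: split_point_snd.
rewrite val_into// row'_snoc row_snoc_last normalize_mulmxK//.
  exact: transportK row_free_frame fp.
by case: (set_typeP x).
Qed.

Lemma cvg_transport (T : Type) (F : set_system T) (FF : Filter F)
    (p q : T -> 'M[R]_(m.+1, m.+2)) (p0 q0 : 'M[R]_(m.+1, m.+2)) : row_free p0 ->
  p t @[t --> F] --> p0 -> q t @[t --> F] --> q0 ->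
  transport (p t) (q t) @[t --> F] --> transport p0 q0.
Proof.
move=> fp cp cq; apply: cvg_mulmx; last exact: cvg_normal_frame.
by apply: cvg_invmx; [exact: normal_frame_unit|exact: cvg_normal_frame].
Qed.

Lemma split_point_continuous : continuous split_point.
Proof.
have cr : continuous (fun M : confW R m.+1 m.+2 m.+1 =>
    row' ord_max (val M) : 'M[R]_(m.+1, m.+2)).
  move=> M; have c := @val_set_continuous _ (confW R m.+1 m.+2 m.+1) M.
  exact: (@cvg_row' R _ (nbhs M) (nbhs_filter M) _ _ ord_max _ _ c).
apply: cts_pair; first by apply: into_continuous => // M; exact: split_point_fst.
apply: (@into_continuous _ _ (confW R m.+1 m.+2 m.+1)) => M; first exact: split_point_snd.
have cv : (fun M : confW R m.+1 m.+2 m.+1 => val M) @ M --> val M.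
  exact: val_set_continuous.
have fp := confW_row_free (split_point_fst M).
apply: (@cvg_normalize _ _ _ (nbhs M)).
  apply: mulmx_neq0; first exact: transport_unit row_free_frame.
  by apply: sphere_neq0; case: (set_typeP M) => /(_ ord_max).
apply: cvg_mulmx; first exact: cvg_row.
by apply: cvg_transport => //; [exact: cr|exact: cvg_cst].
Qed.

Lemma join_point_continuous : continuous join_point.
Proof.
apply: into_continuous => y; first exact: join_pointP.
have fp := confW_row_free (set_typeP y.1).
have c1 : val z.1 @[z --> y] --> val y.1.
  apply: (@continuous_comp (W * Q)%type W _ fst (fun p : W => val p)); first exact: cvg_fst.
  exact: val_set_continuous.
have c2 : val z.2 @[z --> y] --> val y.2.
  apply: (@continuous_comp (W * Q)%type Q _ snd (fun p : Q => val p)); first exact: cvg_snd.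
  exact: val_set_continuous.
apply: cvg_snoc => //; apply: cvg_normalize.
  apply: mulmx_neq0; first exact: transport_unit row_free_frame fp.
  by apply: sphere_neq0; case: (set_typeP y.2).
apply: cvg_mulmx => //; apply: cvg_transport => //; first exact: row_free_frame.
exact: cvg_cst.
Qed.

Lemma split_point_base :
  split_point (b_confW R m.+1 (leqnn m.+2)) =
  (b_confW R m.+1 (leqnSn m.+1), e_confQ R m m.+1).
Proof.
have rb : row' ord_max (frame R m.+2 m.+2) = b.
  apply/row_matrixP => i; rewrite row_frame.
  by apply/rowP => j; rewrite !mxE /= /bump leqNgt ltn_ord.
congr pair; apply/val_inj.
  by rewrite val_into /= rb//; exact: frame_confW.
rewrite val_into; last exact: split_point_snd.
rewrite /= rb row_frame (_ : transport b b = 1%:M).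
  rewrite mulmx1 normalize_id//; exact: (sphere_basis_vec R ord_max).
by rewrite /transport mulVmx// normal_frame_unit// row_free_frame.
Qed.

Lemma isomorphic_confW_prod q :
  isomorphic (homotopy_group R q.+1 (b_confW R m.+1 (leqnn m.+2)))
    (homotopy_group R q.+1 (b_stiefel R (leqnSn m.+1)) *
     homotopy_group R q.+1 (e_confQ R m m.+1))%type.
Proof.
have h := @isomorphic_homeo R _ _ _ _ _ _ q split_point_continuous
  join_point_continuous split_pointK join_pointK split_point_base.
apply: isomorphic_trans h _.
apply: isomorphic_trans (isomorphic_homotopy_prod _ _ _ q) _.
apply: isomorphic_prod; last exact: isomorphic_refl.
exact: isomorphic_confW_stiefel.
Qed.

End LastPoint.

(** * Adding a point in general position *)

Section SignOnCube.
Variables (R : realType) (n : nat) (g : 'rV[R]_n -> R).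

(** The cube is star-shaped about the corner 0, so the intermediate value theorem
    on segments suffices. *)
Lemma cube_positive :
  {within @unit_cube R n, continuous g} -> (forall s, unit_cube s -> g s != 0) ->
  0 < g 0 -> forall s, unit_cube s -> 0 < g s.
Proof.
move=> cg gn0 g0 s cs; rewrite lt_neqAle eq_sym gn0//= leNgt; apply/negP => gs.
have cube_scale (t : R) : `[0, 1]%classic t -> unit_cube (t *: s).
  rewrite /= in_itv /= => t01 i; rewrite mxE; have := cs i; nra.
have cgs : {within `[0, 1], continuous (g \o (fun t : R => t *: s))}.
  apply: within_comp cg _ cube_scale => t.
  by apply: cvg_scalemx; [exact: cvg_id|exact: cvg_cst].
have [||t t01 gt0] := @IVT R _ 0 1 0 _ cgs; first exact: ler01.
  by rewrite /= scale0r scale1r ge_min le_max (ltW g0) (ltW gs) orbT.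
by have := gn0 _ (cube_scale t t01); rewrite [g _]gt0 eqxx.
Qed.

End SignOnCube.

Section Barycentre.
Variables (R : realType) (m : nat).
Local Notation W := (confW R m.+1 m.+1 m).
Local Notation W' := (confW R m.+1 m.+2 m).
Local Notation M := ('M[R]_m.+1).

Lemma confW_unit (p : M) : W p -> p \in unitmx.
Proof. by move/confW_row_free; rewrite row_free_unit. Qed.

(** The spans of [m] of the [m.+1] basis vectors are the coordinate hyperplanes,
    in the coordinates given by [p]. *)
Lemma confQ_coord (p : M) (x : 'rV[R]_m.+1) : p \in unitmx -> enorm x = 1 ->
  confQ m p x <-> exists i, (x *m invmx p) 0 i = 0.
Proof.
move=> up ux; have fp : row_free p by rewrite row_free_unit.
have xE : x = \sum_i (x *m invmx p) 0 i *: row i p.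
  by rewrite -mulmx_sum_row mulmxKV.
split=> [[I /= cI [_]]|[i ci]].
  rewrite free_cons (row_free_subfamily I fp) andbT negbK => xI.
  have [i iI] : exists i, i \notin I.
    apply/existsP; rewrite -negb_forall; apply/negP => /forallP allI.
    have : #|I| = m.+1 by rewrite -[RHS]card_ord; apply: eq_card => i; rewrite allI.
    by rewrite cI => /eqP; rewrite ltn_eqF.
  exists i; rewrite (@coord_span _ _ _ (image_tuple _ _) _ xI) mulmx_suml summxE.
  rewrite big1// => j _; rewrite nth_image -scalemxAl -row_mul mulmxV// !mxE.
  case: eqP => [ji|_]; last by rewrite mulr0.
  by move: iI; rewrite -ji enum_valP.
exists (~: [set i])%SET; first by rewrite /= cardsC1 card_ord.
split=> //; rewrite free_cons negb_and negbK; apply/orP; left.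
rewrite {1}xE; apply: memv_suml => j _.
have [->|ji] := eqVneq j i; first by rewrite ci scale0r mem0v.
by apply/memvZ/memv_span/fintype.image_f; rewrite !inE.
Qed.

Lemma coord_mulmx_neq0 (p : M) (c : 'rV[R]_m.+1) i :
  p \in unitmx -> c 0 i != 0 -> c *m p != 0.
Proof.
move=> up ci; apply: mulmx_neq0 => //; apply: contra_neq ci => ->.
by rewrite mxE.
Qed.

(** Normalization multiplies the coordinates by a positive number, so it keeps
    the point off the coordinate hyperplanes. *)
Lemma confW_snoc_coord (p : M) (c : 'rV[R]_m.+1) : W p -> (forall i, c 0 i != 0) ->
  W' (snoc p (normalize (c *m p))).
Proof.
move=> Wp c0; have up := confW_unit Wp.
have cp0 : c *m p != 0 by exact: coord_mulmx_neq0 (c0 ord0).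
apply/confW_snoc; split=> //; split; first exact: enorm_normalize.
have ux := enorm_normalize cp0.
move=> /(confQ_coord up ux)[i]; rewrite -scalemxAl mulmxK// mxE => /eqP.
by rewrite mulf_eq0 (negbTE (c0 i)) orbF invr_eq0 gt_eqF// enorm_gt0.
Qed.

Lemma confW_row' (N : 'M[R]_(m.+2, m.+1)) : W' N ->
  W (row' ord_max N : M) /\
  forall i, (row ord_max N *m invmx (row' ord_max N : M)) 0 i != 0.
Proof.
rewrite -{1}[N]snoc_row' => /confW_snoc[Wp [ux nQ]]; split=> // i.
apply/eqP => ci; apply: nQ; apply/confQ_coord => //; last by exists i.
exact: confW_unit.
Qed.

(** The coordinates of the last point in the basis of the others move straight to
    (1, ..., 1). The path stays off the coordinate hyperplanes when it starts in
    the open positive orthant. *)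
Definition towards_sum (y : 'M[R]_(m.+2, m.+1) * R) : 'M[R]_(m.+2, m.+1) :=
  let p := row' ord_max y.1 : M in
  snoc p (normalize (((1 - y.2) *: (row ord_max y.1 *m invmx p) +
                      y.2 *: const_mx 1) *m p)).

Lemma cvg_towards_sum N t : W' N ->
  (forall i, ((1 - t) *: (row ord_max N *m invmx (row' ord_max N : M)) +
      t *: const_mx 1) 0 i != 0) ->
  {for (N, t), continuous towards_sum}.
Proof.
move=> WN c0; have [Wp _] := confW_row' WN; have up := confW_unit Wp.
have c1 : (fun y : 'M[R]_(m.+2, m.+1) * R => y.1) @ (N, t) --> N by exact: cvg_fst.
have c2 : (fun y : 'M[R]_(m.+2, m.+1) * R => y.2) @ (N, t) --> t by exact: cvg_snd.
have c3 : (fun y : 'M[R]_(m.+2, m.+1) * R => row' ord_max y.1 : M) @ (N, t) -->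
    (row' ord_max N : M) by exact: (@cvg_row' _ _ _ _ m.+2 m.+1 ord_max).
have F1 : Filter (nbhs (N, t)) by exact: nbhs_filter.
apply: (@cvg_snoc _ _ (nbhs (N, t))) => //; apply: (@cvg_normalize _ _ _ (nbhs (N, t))).
  exact: coord_mulmx_neq0 (c0 ord0).
apply: cvg_mulmx => //; apply: cvg_addmx.
  apply: cvg_scalemx; first exact: (cvgB (cvg_cst (1 : R)) c2).
  by apply: cvg_mulmx; [exact: cvg_row|exact: cvg_invmx].
by apply: cvg_scalemx => //; exact: cvg_cst.
Qed.

Definition first_points (x : W') : W :=
  into (b_confW R m.+1 (leqnn m.+1)) (row' ord_max (val x) : M).

Definition add_sum (p : W) : W' :=
  into (b_tilde_confW R m) (snoc (val p) (normalize (const_mx 1 *m val p))).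

Lemma val_first_points x : val (first_points x) = row' ord_max (val x).
Proof. by rewrite val_into//; have [] := confW_row' (set_typeP x). Qed.

Lemma add_sumP (p : W) : W' (snoc (val p) (normalize (const_mx 1 *m val p))).
Proof.
by apply: confW_snoc_coord => [|i]; [exact: set_typeP|rewrite mxE oner_neq0].
Qed.

Lemma val_add_sum p : val (add_sum p) = snoc (val p) (normalize (const_mx 1 *m val p)).
Proof. by rewrite val_into//; exact: add_sumP. Qed.

Lemma first_points_continuous : continuous first_points.
Proof.
apply: into_continuous => x; first by have [] := confW_row' (set_typeP x).
have c := @val_set_continuous _ W' x.
exact: (@cvg_row' R _ (nbhs x) (nbhs_filter x) _ _ ord_max _ _ c).
Qed.

Lemma add_sum_continuous : continuous add_sum.
Proof.
apply: (@into_continuous _ _ W) => p; first exact: add_sumP.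
have up := confW_unit (set_typeP p).
have cp : (fun p : W => val p) @ p --> val p by exact: val_set_continuous.
apply: (@cvg_snoc _ _ (nbhs p)) => //; apply: (@cvg_normalize _ _ _ (nbhs p)).
  by apply: (coord_mulmx_neq0 (i := ord0)); rewrite ?mxE ?oner_neq0.
by apply: cvg_mulmx => //; exact: cvg_cst.
Qed.

Lemma add_sumK : cancel add_sum first_points.
Proof. by move=> p; apply/val_inj; rewrite val_first_points val_add_sum row'_snoc. Qed.

Lemma add_sum_base :
  add_sum (b_confW R m.+1 (leqnn m.+1)) = b_tilde_confW R m.
Proof.
apply/val_inj; rewrite val_add_sum /=; apply/row_matrixP => i; rewrite !rowK.
case: unliftP => [j|] ->; first by rewrite lift_max ltn_ord row_frame.
rewrite /= ltnn /normalize (_ : const_mx 1 *m _ = frame_sum R m.+1 m.+1)//.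
rewrite mulmx_sum_row; apply: eq_bigr => j _.
by rewrite mxE scale1r row_frame.
Qed.

(** The fibre of [first_points] is a union of open orthants of the sphere. A
    spheroid starts with positive coordinates and none of them can vanish, so it
    stays in the positive orthant, which contracts to the normalized sum of the
    first points. *)
Lemma isomorphic_confW_tilde q :
  isomorphic (homotopy_group R q.+1 (b_tilde_confW R m))
             (homotopy_group R q.+1 (b_confW R m.+1 (leqnn m.+1))).
Proof.
apply: (isomorphic_homotopy_group first_points_continuous add_sum_continuous).
- by rewrite -add_sum_base add_sumK.
- exact: add_sum_base.
- move=> f Sf; apply: homotopic_sym.
  pose c (x : W') := row ord_max (val x) *m invmx (row' ord_max (val x) : M).
  have cc i : continuous (fun x : W' => c x 0 i).
    move=> x; have cx := @val_set_continuous _ W' x.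
    have cp := @cvg_row' R _ (nbhs x) (nbhs_filter x) _ _ ord_max _ _ cx.
    have [Wp _] := confW_row' (set_typeP x).
    apply: (@cvg_entry _ _ (nbhs x)); apply: (@cvg_mulmx _ _ (nbhs x)).
      exact: (@cvg_row R _ (nbhs x)).
    by apply: (@cvg_invmx _ _ (nbhs x)); [exact: confW_unit|exact: cp].
  have c_base i : 0 < c (b_tilde_confW R m) 0 i.
    have up := confW_unit (set_typeP (b_confW R m.+1 (leqnn m.+1))).
    rewrite -add_sum_base /c val_add_sum row_snoc_last row'_snoc.
    rewrite -scalemxAl mulmxK// !mxE mulr1 invr_gt0 enorm_gt0//.
    by apply: (coord_mulmx_neq0 (i := ord0)); rewrite ?mxE ?oner_neq0.
  have c_pos i s : unit_cube s -> 0 < c (f s) 0 i.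
    apply: (@cube_positive _ _ (fun s => c (f s) 0 i)) => [|{}s cs|].
    + exact: within_continuous_comp Sf.1 (cc i).
    + by have [_] := confW_row' (set_typeP (f s)); apply.
    (* the corner 0 lies on the boundary, where [f] is at the base point *)
    + rewrite Sf.2//; split; first by move=> j; rewrite mxE lexx ler01.
      by exists ord0; left; rewrite mxE.
  (* convex combinations of positive numbers are positive *)
  have ct s t i : unit_cube s -> 0 <= t <= 1 ->
      ((1 - t) *: c (f s) + t *: const_mx 1) 0 i != 0.
    move=> cs t01; rewrite !mxE mulr1; apply: lt0r_neq0.
    have := c_pos i s cs; rewrite /c mxE; nra.
  have Ht s t : unit_cube s -> 0 <= t <= 1 -> W' (towards_sum (val (f s), t)).
    move=> cs t01; apply: confW_snoc_coord => [|i]; last exact: ct.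
    by have [] := confW_row' (set_typeP (f s)).
  exists (fun y => into (b_tilde_confW R m) (towards_sum (val (f y.1), y.2))); split.
  + apply: within_into => [[s t] [/= cs]|].
      by rewrite in_itv /= => t01; exact: Ht.
    apply: (within_cylinder Sf.1) => s t cs t01.
    exact: cvg_towards_sum (set_typeP (f s)) (fun i => ct s t i cs t01).
  + move=> s cs /=; apply/val_inj; rewrite val_into; last by apply: Ht; rewrite ?lexx ?ler01.
    have up := confW_unit (confW_row' (set_typeP (f s))).1.
    rewrite /towards_sum /= subr0 scale1r scale0r addr0 mulmxKV// normalize_id ?snoc_row'//.
    by case: (set_typeP (f s)) => /(_ ord_max).
  + move=> s cs /=; apply/val_inj; rewrite val_into; last by apply: Ht; rewrite ?lexx ?ler01.
    rewrite val_add_sum val_first_points /towards_sum /= subrr scale0r add0r scale1r.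
    by [].
  + move=> s t bs t01 /=; have cs := bs.1; apply/val_inj; rewrite val_into; last exact: Ht.
    rewrite Sf.2// -add_sum_base; set p := b_confW R _ _.
    have up : val p \in unitmx := confW_unit (set_typeP p).
    rewrite /towards_sum /= val_add_sum row'_snoc row_snoc_last -scalemxAl mulmxK//.
    rewrite scalerA -scalerDl -scalemxAl normalizeZ//.
    have : 0 < (enorm (const_mx 1 *m val p : 'rV[R]_m.+1))^-1.
      rewrite invr_gt0 enorm_gt0//.
      by apply: (coord_mulmx_neq0 (i := ord0)); rewrite ?mxE ?oner_neq0.
    nra.
- move=> g Sg; rewrite (_ : _ \o g = g); first exact: homotopic_refl.
  by apply/funext => s /=; rewrite add_sumK.
Qed.

End Barycentre.

Close Scope ring_scope.
Close Scope classical_set_scope.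
Close Scope quotient_scope.

Theorem theorem1p2 (R : realType) (m : nat) (m_ge1 : 1 <= m) :
  [/\ (forall (k n : nat) (k_ge1 : 1 <= k) (k_eq : k = n) (n_le : n <= m.+1)
              (q : nat),
         isomorphic (homotopy_group R q.+1 (b_confW R k n_le))
                    (homotopy_group R q.+1 (b_stiefel R n_le))),
      (forall q : nat,
         isomorphic
           (homotopy_group R q.+1 (b_confW R m (leqnn m.+1)))
           (homotopy_group R q.+1 (b_stiefel R (leqnSn m)) *
            homotopy_group R q.+1 (e_confQ R m.-1 m))%type) &
      (forall q : nat,
         isomorphic (homotopy_group R q.+1 (b_tilde_confW R m))
                    (homotopy_group R q.+1 (b_stiefel R (leqnn m.+1))))].
Proof.
split=> [k n _ -> n_le q|q|q].
- exact: isomorphic_confW_stiefel.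
- by case: m m_ge1 => // m' _; exact: isomorphic_confW_prod.
- apply: isomorphic_trans (isomorphic_confW_tilde R m q) _.
  exact: isomorphic_confW_stiefel.
Qed.
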